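(* Let $P$ be a Dyck path of size $n$ and let $w$ be the $321$-avoiding permutation in $S_n$ corresponding to $P$. Then $$\widehat{RSK}(w)=\partial\circ\mathrm{Mat}\circ\mathrm{ev}(P).$$
   Context: A Dyck path of size $n$ is a lattice path from $(0,0)$ to $(n,n)$ with steps $U=(0,1)$, $R=(1,0)$, weakly above $y=x$, identified with its word of length $2n$. Correspondence $w\leftrightarrow P$: for a $321$-avoiding $w\in S_n$, $P=p(w)$ is the Dyck path whose peaks (corners $UR$) are exactly the points $(i-1,w_i)$ with $w_i\ge i$; this is a bijection. $\widehat{RSK}$: let $(A,B)$ be the pair (insertion tableau, recording tableau) of $w$ under Robinson--Schensted row insertion; since $w$ is $321$-avoiding both have at most two rows. $\widehat{RSK}(w)$ is the Dyck path whose $i$-th step ($1\le i\le n$) is $U$ if $i$ is in the first row of $A$ and $R$ if $i$ is in the second row, and whose $(2n+1-i)$-th step is $R$ if $i$ is in the first row of $B$ and $U$ if $i$ is in the second row. Promotion and evacuation: products are compositions, rightmost factor first. With $N=2n$, the toggle $t_i$ ($1\le i\le N-1$) exchanges the $i$-th and $(i+1)$-st letters of the word if the result is a Dyck path and otherwise fixes the path. $\partial=t_{N-1}\cdots t_2t_1$, $\mathrm{ev}=t_1(t_2t_1)\cdots(t_{N-1}\cdots t_2t_1)$. Matching map $\mathrm{Mat}$ (Armstrong--Stump--Thomas): write $\bar i=2n+1-i$. For a Dyck path $P$, number its rows $1,\dots,n$ from the top. Set $k_i=n-j+1$ if the up step in the $i$-th row is immediately preceded by a right step (there is a valley $RU$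 in that row), where that right step lies in the $j$-th column from the left; otherwise set $k_i=\bar i$ (a ''barred'' integer). Starting from $I=[1,2n]$, for $i=1,2,\dots,n$ successively: if $k_i$ is unbarred let $l_i$ be the largest element of $I$ smaller than $k_i$, if $k_i$ is barred let $l_i$ be the smallest element of $I$ larger than $k_i$ (cyclically, i.e. integers are considered modulo $2n$); then remove $k_i,l_i$ from $I$. The pairs $\{k_i,l_i\}$ form a non-crossing perfect matching of $[1,2n]$, and $\mathrm{Mat}(P)$ is the Dyck path whose up steps are at the positions that are the smaller elements of their pairs. *)

(* Defs.v *)
From mathcomp Require Import all_boot all_fingroup.

Set Implicit Arguments.
Unset Strict Implicit.
Unset Printing Implicit Defensive.

(* A lattice path from the origin is the word of its steps. *)
Definition step := bool.
Definition Up : step := true.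
Definition Rt : step := false.
Definition path_word := seq step.

(* The path after m steps is at the point (x, y) = (xcoord s m, ycoord s m). *)
Definition xcoord (s : path_word) (m : nat) : nat := count_mem Rt (take m s).
Definition ycoord (s : path_word) (m : nat) : nat := count_mem Up (take m s).

Definition dyck (n : nat) (s : path_word) : bool :=
  [&& count_mem Up s == n, count_mem Rt s == n &
      all (fun m => xcoord s m <= ycoord s m) (iota 0 (size s).+1)].

(* (x, y) is a corner between an up step and the right step following it. *)
Definition is_peak (s : path_word) (x y : nat) : Prop :=
  exists m : nat,
    [/\ 0 < m < size s, nth Rt s m.-1 = Up, nth Up s m = Rt,
        xcoord s m = x & ycoord s m = y].

(* Permutations of {1, ..., n} are encoded on 'I_n = {0, ..., n - 1}:
   the entry w_i of the one-line notation is (w (i - 1)).+1. *)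
Definition avoids321 (n : nat) (w : 'S_n) : Prop :=
  forall i j k : 'I_n, i < j -> j < k -> ~ (w k < w j /\ w j < w i).

(* P = p(w): with i0 = i - 1, the point (i - 1, w_i) is (i0, (w i0).+1), and
   w_i >= i reads i0 <= w i0. *)
Definition corresponds (n : nat) (w : 'S_n) (P : path_word) : Prop :=
  forall x y : nat,
    is_peak P x y <->
    exists i0 : 'I_n, [/\ i0 <= w i0, x = i0 & y = (w i0).+1].

(* Row insertion; the second component is the bumped entry, if any. *)
Fixpoint row_insert (x : nat) (r : seq nat) : seq nat * option nat :=
  match r with
  | [::] => ([:: x], None)
  | y :: r' =>
      if x < y then (x :: r', Some y)
      else let: (r'', b) := row_insert x r' in (y :: r'', b)
  end.

(* The second component is the (0-based) index of the row of the new cell. *)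
Fixpoint tab_insert (x : nat) (T : seq (seq nat)) : seq (seq nat) * nat :=
  match T with
  | [::] => ([:: [:: x]], 0)
  | r :: T' =>
      match row_insert x r with
      | (r', None) => (r' :: T', 0)
      | (r', Some y) => let: (T'', k) := tab_insert y T' in (r' :: T'', k.+1)
      end
  end.

Definition RS_step (AB : seq (seq nat) * seq (seq nat)) (xi : nat * nat) :
    seq (seq nat) * seq (seq nat) :=
  let: (A', k) := tab_insert xi.1 AB.1 in
  (A', set_nth [::] AB.2 k (rcons (nth [::] AB.2 k) xi.2)).

(* (insertion tableau, recording tableau), each as its list of rows. *)
Definition RS (v : seq nat) : seq (seq nat) * seq (seq nat) :=
  foldl RS_step ([::], [::]) (zip v (iota 1 (size v))).

Definition one_line (n : nat) (w : 'S_n) : seq nat :=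
  [seq (w i).+1 | i <- enum 'I_n].

(* The tableaux of a 321-avoiding permutation have at most two rows, so an
   entry outside the first row is in the second one.  The second half of the
   word is listed at the positions 2n+1-i for i = n, ..., 1. *)
Definition RSKhat_word (v : seq nat) : path_word :=
  let: (A, B) := RS v in
  let n := size v in
  [seq if i \in nth [::] A 0 then Up else Rt | i <- iota 1 n] ++
  [seq if i \in nth [::] B 0 then Rt else Up | i <- rev (iota 1 n)].

Definition RSKhat (n : nat) (w : 'S_n) : path_word := RSKhat_word (one_line w).

(* Letters are numbered from 1: the i-th letter is nth _ s i.-1. *)
Definition swap_letters (i : nat) (s : path_word) : path_word :=
  set_nth Rt (set_nth Rt s i.-1 (nth Rt s i)) i (nth Rt s i.-1).

Definition toggle (n i : nat) (s : path_word) : path_word :=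
  if dyck n (swap_letters i s) then swap_letters i s else s.

(* t_k ... t_2 t_1, with t_1 applied first *)
Definition partial_promotion (n k : nat) (s : path_word) : path_word :=
  foldl (fun s' i => toggle n i s') s (iota 1 k).

Definition promotion (n : nat) (s : path_word) : path_word :=
  partial_promotion n (n.*2).-1 s.

(* t_1 (t_2 t_1) ... (t_{N-1} ... t_2 t_1): the longest block acts first. *)
Definition evacuation (n : nat) (s : path_word) : path_word :=
  foldl (fun s' k => partial_promotion n k s') s (rev (iota 1 (n.*2).-1)).

(* The number of steps before the up step in the i-th row from the top, which
   is the (n - i + 1)-st up step of the word. *)
Definition row_pos (n i : nat) (s : path_word) : nat :=
  nth 0 [seq m <- iota 0 (size s) | nth Rt s m == Up] (n - i).

Variant key : Type := Unbarred of nat | Barred of nat.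

(* Barred i stands for the integer 2n+1-i. *)
Definition key_val (n : nat) (k : key) : nat :=
  match k with Unbarred a => a | Barred i => n.*2.+1 - i end.

(* A right step ending at abscissa j lies in the j-th column from the left. *)
Definition mat_key (n : nat) (s : path_word) (i : nat) : key :=
  let m := row_pos n i s in
  if (0 < m) && (nth Up s m.-1 == Rt) then Unbarred (n - xcoord s m + 1)
  else Barred i.

(* I is listed in increasing order; cyclically, the largest element smaller
   than k is the maximum of I when no element of I is smaller than k, and
   symmetrically. *)
Definition mat_partner (n : nat) (k : key) (I : seq nat) : nat :=
  match k with
  | Unbarred _ => last (last 0 I) [seq x <- I | x < key_val n k]
  | Barred _ => head (head 0 I) [seq x <- I | key_val n k < x]
  end.

Fixpoint mat_pairs (n : nat) (ks : seq key) (I : seq nat) : seq (nat * nat) :=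
  match ks with
  | [::] => [::]
  | k :: ks' =>
      let l := mat_partner n k I in
      (key_val n k, l) ::
      mat_pairs n ks' [seq x <- I | (x != key_val n k) && (x != l)]
  end.

Definition matching (n : nat) (s : path_word) : seq (nat * nat) :=
  mat_pairs n [seq mat_key n s i | i <- iota 1 n] (iota 1 n.*2).

Definition Mat (n : nat) (s : path_word) : path_word :=
  [seq if p \in [seq minn kl.1 kl.2 | kl <- matching n s] then Up else Rt
  | p <- iota 1 n.*2].

(* Main.v *)
Require Import Defs.
From mathcomp Require Import all_boot all_fingroup.
From mathcomp Require Import zify.

Set Implicit Arguments.
Unset Strict Implicit.
Unset Printing Implicit Defensive.

(** Two reductions come first.  On Dyck words evacuation is the reflection of
    the path in the antidiagonal ([evacuationE]), and promotion rotates the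
    matching of a path by one position ([promotion_first_return],
    [promotion_mins_word]).  Write M_t for the maximum of the first t values of
    w; it is the height of the t-th right step of P.  Reading the valleys of
    the reflected path as valleys of P ([mat_key_reflect]) and rotating turns
    the 2n positions into the values 1, ..., n followed by the times n-1, ...,
    1, 0 of insertion (numbered from 0), exactly as in the word of the two
    tableaux.  The keys become, for t
    from 1 to n: the value M_t if t is the time of a weak excedance (that is, of
    a new maximum), and the time t itself otherwise.

    The path of a perfect matching only records which end of each pair comes
    first.  So it is enough to show that, in each pair of the rotated matching,
    the tableau word has an up step at the first end and a right step at the
    second one.  Values that are not maxima are never bumped and times of new
    maxima never bump, so these ends always have the expected letters, and two
    statements remain.  (The position of time n is that of the value n = M_n, so
    that the last key comes under the first statement.)
    - At the time t of a new maximum, M_t is paired with a smaller value if M_t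
      is bumped at some time, and with an earlier time if it never is.
    - At any other time t, the time t is paired with an earlier time if the
      insertion at t bumps, and with a value below M_t if it does not.

    Which case of the matching procedure applies depends on whether earlier
    times, or smaller values, are still free, and this is settled by counting
    ([free_times]).  The number of free earlier times is the number of bumps to
    come of entries not exceeding M_t, plus 1 if M_t is never bumped.  A bump of
    such an entry is caused by a value below M_t still to be inserted; and as
    long as M_t stays in the row, each of these values does cause one.  Since
    the entries that are not maxima are inserted in increasing order, a failure
    to bump shows that no older entry will be bumped later.  These facts are
    the lemmas [free_times_exc], [free_times_def_bump] and
    [free_times_def_nobump]; [invariant_step] runs the matching procedure along
    with them. *)

(** * Toggles, promotion and evacuation *)

Definition nU (s : path_word) : nat := count_mem Up s.
Definition nR (s : path_word) : nat := count_mem Rt s.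
Arguments nU : simpl never.
Arguments nR : simpl never.

(** The number of right steps left unmatched when up and right steps are
    paired as opening and closing parentheses; [s] is ballot when it is 0. *)
Fixpoint unmatched (s : path_word) : nat :=
  if s is c :: s' then
    if c == Up then (unmatched s').-1 else (unmatched s').+1
  else 0.

Lemma nU_cat s t : nU (s ++ t) = nU s + nU t.
Proof. exact: count_cat. Qed.

Lemma nR_cat s t : nR (s ++ t) = nR s + nR t.
Proof. exact: count_cat. Qed.

Lemma nU_cons c s : nU (c :: s) = (c == Up) + nU s.
Proof. by []. Qed.

Lemma nR_cons c s : nR (c :: s) = (c == Rt) + nR s.
Proof. by []. Qed.

Lemma nU_rcons s c : nU (rcons s c) = nU s + (c == Up).
Proof. by rewrite -cats1 nU_cat /= nU_cons addn0. Qed.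

Lemma nR_rcons s c : nR (rcons s c) = nR s + (c == Rt).
Proof. by rewrite -cats1 nR_cat /= nR_cons addn0. Qed.

Lemma nU_nR s : nU s + nR s = size s.
Proof. by elim: s => [|[] s IHs] //=; rewrite nU_cons nR_cons /= -IHs; lia. Qed.

(** Links the condition on prefixes to [unmatched], which follows the letters of
    the word one by one; [h] is the height already reached before [s]. *)
Lemma unmatched_le h s :
  reflect (forall j, j <= size s -> nR (take j s) <= nU (take j s) + h)
          (unmatched s <= h).
Proof.
apply: (iffP idP); elim: s h => [|c s IHs] h //=.
- case: c => /= H [|j] // /IHs Hj /=; rewrite nU_cons nR_cons /=.
  + by have := Hj h.+1; lia.
  + by have := Hj h.-1; lia.
- case: c => /= H.
  + suff: unmatched s <= h.+1 by lia.
    by apply: IHs => j Hj; have := H j.+1 Hj; rewrite /= nU_cons nR_cons /=; lia.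
  + have := H 1 isT; rewrite /= take0 nU_cons nR_cons /= => H1.
    suff: unmatched s <= h.-1 by rewrite /nU /= in H1; lia.
    apply: IHs => j Hj; have := H j.+1 Hj; rewrite /= nU_cons nR_cons /=.
    by rewrite /nU /= in H1; lia.
Qed.

Lemma dyckE n s : dyck n s = [&& nU s == n, nR s == n & unmatched s == 0].
Proof.
rewrite /dyck -/(nU s) -/(nR s); congr [&& _, _ & _].
apply/allP/idP => [H | H m].
- rewrite -leqn0; apply/unmatched_le => j Hj.
  by have := H j; rewrite mem_iota addn0; apply.
- rewrite mem_iota => /andP[_ Hm]; rewrite -leqn0 in H.
  by move/unmatched_le: H => /(_ m Hm); rewrite addn0.
Qed.

Lemma unmatched_cat x t :
  (unmatched (x ++ t) == 0) = (unmatched x == 0) && (nR x + unmatched t <= nU x).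
Proof.
suff H h : (unmatched (x ++ t) <= h)
           = (unmatched x <= h) && (nR x + unmatched t <= nU x + h).
  by have := H 0; rewrite !leqn0 addn0.
elim: x h => [|[] x IHx] h /=; rewrite ?nU_cons ?nR_cons /=.
- by rewrite add0n.
- have -> a : (a.-1 <= h) = (a <= h.+1) by lia.
  by rewrite IHx; lia.
- by case: h => [|h]; [lia | rewrite ltnS IHx; lia].
Qed.

Lemma unmatched_bal s : nR s <= unmatched s + nU s.
Proof. by elim: s => [|[] s IHs] //=; rewrite nU_cons nR_cons /=; lia. Qed.

Lemma set_nth_mid (x : path_word) d c e z :
  set_nth d (x ++ c :: z) (size x) e = x ++ e :: z.
Proof. by elim: x => [|a x IHx] //=; rewrite IHx. Qed.

Lemma swap_letters_mid x c d z :
  swap_letters (size x).+1 (x ++ c :: d :: z) = x ++ d :: c :: z.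
Proof.
rewrite /swap_letters succnK.
have -> : nth Rt (x ++ c :: d :: z) (size x) = c by rewrite nth_cat ltnn subnn.
have -> : nth Rt (x ++ c :: d :: z) (size x).+1 = d.
  by rewrite nth_cat ltnNge leqnSn subSnn.
by rewrite set_nth_mid -cat_rcons -(size_rcons x d) set_nth_mid cat_rcons.
Qed.

Lemma toggle_eq n x c z :
  toggle n (size x).+1 (x ++ c :: c :: z) = x ++ c :: c :: z.
Proof. by rewrite /toggle swap_letters_mid; case: ifP. Qed.

Lemma toggle_UR n x z : dyck n (x ++ Up :: Rt :: z) ->
  toggle n (size x).+1 (x ++ Up :: Rt :: z) =
  if nR x < nU x then x ++ Rt :: Up :: z else x ++ Up :: Rt :: z.
Proof.
rewrite /toggle swap_letters_mid !dyckE !nU_cat !nR_cat !nU_cons !nR_cons.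
rewrite !unmatched_cat /= => /and3P[-> -> /andP[-> H]] /=.
by congr (if _ then _ else _); lia.
Qed.

Lemma swapped_RU_dyck n x z :
  dyck n (x ++ Rt :: Up :: z) -> dyck n (x ++ Up :: Rt :: z).
Proof.
rewrite !dyckE !nU_cat !nR_cat !nU_cons !nR_cons.
by rewrite !unmatched_cat /= => /and3P[-> -> /andP[-> H]] /=; lia.
Qed.

Lemma toggle_RU n x z : dyck n (x ++ Rt :: Up :: z) ->
  toggle n (size x).+1 (x ++ Rt :: Up :: z) = x ++ Up :: Rt :: z.
Proof. by rewrite /toggle swap_letters_mid => /swapped_RU_dyck ->. Qed.

(** Changes into an up step the first right step that goes below height [-h];
    the effect of promotion on the word that follows the initial up step. *)
Fixpoint slide (h : nat) (y : path_word) : path_word :=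
  if y is c :: y' then
    if c == Up then Up :: slide h.+1 y'
    else if h is h'.+1 then Rt :: slide h' y' else Up :: y'
  else [::].

Lemma size_slide h y : size (slide h y) = size y.
Proof. by elim: y h => [|[] y IHy] [|h] //=; rewrite IHy. Qed.

(** Once the travelling letter is a right step, every later toggle is allowed,
    so that this letter moves unhindered to the end of the range. *)
Lemma toggles_down n x y z : dyck n (x ++ Rt :: y ++ z) ->
  foldl (fun s i => toggle n i s) (x ++ Rt :: y ++ z)
        (iota (size x).+1 (size y)) = x ++ y ++ Rt :: z.
Proof.
elim: y x => [|[] y IHy] x //= H.
- rewrite toggle_RU //; have := swapped_RU_dyck H.
  by rewrite -cat_rcons => /IHy; rewrite size_rcons => ->; rewrite cat_rcons.
- rewrite toggle_eq; move: H; rewrite -cat_rcons => /IHy.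
  by rewrite size_rcons => ->; rewrite cat_rcons.
Qed.

(** The initial up step travels to the right as long as the word skipped stays
    ballot; at the first return it is blocked, and the right step found there
    travels on in its place. *)
Lemma toggles_up n h x y z : nU x = nR x + h -> dyck n (x ++ Up :: y ++ z) ->
  foldl (fun s i => toggle n i s) (x ++ Up :: y ++ z)
        (iota (size x).+1 (size y)) =
  x ++ slide h y ++ (if h < unmatched y then Rt else Up) :: z.
Proof.
elim: y h x => [|[] y IHy] h x Hh //= H.
- rewrite toggle_eq; move: H; rewrite -cat_rcons => /(IHy h.+1).
  rewrite size_rcons nU_rcons nR_rcons Hh => -> /=; last lia.
  by rewrite cat_rcons /=; have -> : (h < (unmatched y).-1) = (h.+1 < unmatched y) by lia.
- rewrite toggle_UR // Hh; case: h Hh => [|h] Hh.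
  + rewrite addn0 ltnn; move: H; rewrite -cat_rcons => /toggles_down.
    by rewrite size_rcons => ->; rewrite cat_rcons.
  + have lt_x : nR x < nR x + h.+1 by lia.
    rewrite lt_x; have H' : dyck n (rcons x Rt ++ Up :: y ++ z).
      have := toggle_UR H; rewrite Hh lt_x /toggle swap_letters_mid cat_rcons.
      case: ifP => // _ E; move/eqP: E.
      by rewrite eqseq_cat // => /andP[].
    rewrite -cat_rcons -(size_rcons x Rt) (IHy h) ?nU_rcons ?nR_rcons ?Hh //=.
      by rewrite cat_rcons.
    lia.
Qed.

Lemma partial_promotionE n y z : dyck n (Up :: y ++ z) ->
  partial_promotion n (size y) (Up :: y ++ z) =
  slide 0 y ++ (if 0 < unmatched y then Rt else Up) :: z.
Proof. exact: (@toggles_up n 0 [::] y z). Qed.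

(** Evacuation of a ballot word [x]: reflect the partial matching of its
    letters, keeping the unmatched up steps as up steps. *)
Fixpoint reflect_word (x : path_word) : path_word :=
  if x is c :: x' then
    rcons (reflect_word x')
          (if (c == Up) && (0 < unmatched x') then Rt else Up)
  else [::].

(** The right step turned into an up step has no partner to its right
    afterwards, so it is reflected to an up step in both words; the other letters
    keep their partners. *)
Lemma reflect_slide h y : unmatched y <= h.+1 ->
  unmatched (slide h y) = minn (unmatched y) h /\
  reflect_word (slide h y) = reflect_word y.
Proof.
elim: y h => [|[] y IHy] h //=; first by rewrite min0n.
- move=> Hy; have /IHy[E1 E2] : unmatched y <= h.+2 by lia.
  rewrite E1 E2; split; first lia.
  by have -> : (0 < minn (unmatched y) h.+1) = (0 < unmatched y) by lia.
- case: h => [|h] Hy /=.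
    have y0 : unmatched y = 0 by lia.
    by rewrite y0.
  have /IHy[E1 E2] : unmatched y <= h.+1 by lia.
  by rewrite E1 E2; split; [lia | ].
Qed.

Lemma toggle_dyck n i s : dyck n s -> dyck n (toggle n i s).
Proof. by rewrite /toggle; case: ifP. Qed.

Lemma partial_promotion_dyck n k s :
  dyck n s -> dyck n (partial_promotion n k s).
Proof.
rewrite /partial_promotion; elim: (iota 1 k) s => //= i r IHr s Hs.
exact/IHr/toggle_dyck.
Qed.

Lemma iota_recr m k : iota m k.+1 = rcons (iota m k) (m + k).
Proof. by rewrite -addn1 iotaD cats1. Qed.

Lemma partial_evacuationE n k x z : size x = k.+1 -> dyck n (x ++ z) ->
  foldl (fun s j => partial_promotion n j s) (x ++ z) (rev (iota 1 k)) =
  reflect_word x ++ z.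
Proof.
elim: k x z => [|k IHk] [|c y] z // [sz_y] Hs.
all: have cU : c = Up by case: c Hs => //; rewrite dyckE /= => /and3P[].
all: subst c.
  by case: y sz_y Hs.
rewrite iota_recr rev_rcons /= add1n -sz_y.
have {}Hs : dyck n (Up :: y ++ z) by [].
rewrite partial_promotionE // IHk.
- have y1 : unmatched y <= 1.
    move: Hs; rewrite dyckE -cat_cons => /and3P[_ _].
    by rewrite unmatched_cat /=; lia.
  by have [_ ->] := reflect_slide y1; rewrite cat_rcons.
- by rewrite size_slide.
- by rewrite -(partial_promotionE Hs); apply: partial_promotion_dyck.
Qed.

(** In a word all of whose suffixes have enough right steps, every up step is
    matched. *)
Lemma reflect_word_rev x :
  (forall j, j <= size x -> nU (drop j x) <= nR (drop j x)) ->
  reflect_word x = rev (map negb x).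
Proof.
elim: x => [|c x IHx] //= H; rewrite rev_cons IHx; last first.
  by move=> j Hj; apply: (H j.+1).
congr rcons; case: c H => //= H; case: ifP => // /negbT.
have := H 0 isT; rewrite /= nU_cons nR_cons /=.
by have := unmatched_bal x; lia.
Qed.

Lemma dyck_suffix n P j : dyck n P -> nU (drop j P) <= nR (drop j P).
Proof.
rewrite -{1}(cat_take_drop j P) dyckE nU_cat nR_cat => /and3P[/eqP a /eqP b].
by rewrite unmatched_cat => /andP[_]; lia.
Qed.

Lemma evacuationE n P : dyck n P -> evacuation n P = rev (map negb P).
Proof.
move=> HP; have szP : size P = n.*2.
  by move: (HP); rewrite dyckE -nU_nR => /and3P[/eqP-> /eqP-> _]; rewrite addnn.
case: n HP szP => [|n] HP szP; first by case: P HP szP.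
rewrite /evacuation -{1}[P]cats0 partial_evacuationE ?cats0 //.
- by apply: reflect_word_rev => j _; apply: dyck_suffix HP.
Qed.

Lemma slide_balanced h a b :
  (forall j, j <= size a -> nR (take j a) <= nU (take j a) + h) ->
  nR a = nU a + h ->
  slide h (a ++ Rt :: b) = a ++ Up :: b.
Proof.
elim: a h => [|[] a IHa] h H E.
- by rewrite /= in E *; case: h {H} E.
- rewrite /= IHa // => [j Hj|].
    by have := H j.+1 Hj; rewrite /= nU_cons nR_cons /=; lia.
  by move: E; rewrite nU_cons nR_cons /=; lia.
- case: h H E => [|h] H E.
    by have := H 1 isT; rewrite /= take0.
  rewrite /= IHa // => [j Hj|].
    by have := H j.+1 Hj; rewrite /= nU_cons nR_cons /=; lia.
  by move: E; rewrite nU_cons nR_cons /=; lia.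
Qed.

(** In terms of matchings, promotion rotates by one step: the first up step
    becomes a final right step, and its partner an up step. *)
Lemma promotion_first_return n a b : dyck n (Up :: a ++ Rt :: b) ->
  (forall j, j <= size a -> nR (take j a) <= nU (take j a)) -> nR a = nU a ->
  promotion n (Up :: a ++ Rt :: b) = rcons (a ++ Up :: b) Rt.
Proof.
move=> H Ha Ea; have sz : (n.*2).-1 = size (a ++ Rt :: b).
  move: (H); rewrite dyckE => /and3P[/eqP hU /eqP hR _].
  by rewrite -addnn -{1}hU -hR nU_nR.
have H' : dyck n (Up :: (a ++ Rt :: b) ++ [::]) by rewrite cats0.
have := partial_promotionE H'; rewrite cats0 /promotion sz => ->.
rewrite slide_balanced ?addn0 //; last by move=> j Hj; rewrite addn0 Ha.
rewrite -cats1; case: ifP => // /negbT.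
have := unmatched_bal (a ++ Rt :: b).
move: H; rewrite dyckE => /and3P[/eqP + /eqP + _].
by rewrite nU_cons nR_cons /=; lia.
Qed.

(** * Non-crossing matchings built by successive removal of neighbours *)

Definition remaining n (k : key) (I : seq nat) : seq nat :=
  [seq x <- I | (x != key_val n k) && (x != mat_partner n k I)].

(** The procedure removes a key whether or not it is still present; it yields
    a perfect matching as soon as each key is present at its turn. *)
Fixpoint keys_available n (ks : seq key) (I : seq nat) : bool :=
  if ks is k :: ks' then
    (key_val n k \in I) && keys_available n ks' (remaining n k I)
  else true.

Lemma sorted_last d s : sorted ltn s -> s != [::] ->
  last d s \in s /\ {in s, forall z, z <= last d s}.
Proof.
case/lastP: s => // s x; rewrite -(revK (rcons s x)) rev_sorted rev_rcons /=.
move=> /(order_path_min (rev_trans ltn_trans)) /allP H _; rewrite rev_cons last_rcons revK.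
rewrite mem_rcons inE eqxx; split=> // z; rewrite mem_rcons inE.
by case/predU1P=> [->//|zs]; apply/ltnW/H; rewrite mem_rev.
Qed.

Lemma sorted_head d s : sorted ltn s -> s != [::] ->
  head d s \in s /\ {in s, forall z, head d s <= z}.
Proof.
case: s => //= x s /(order_path_min ltn_trans) /allP H _.
rewrite inE eqxx; split=> // z; rewrite inE.
by case/predU1P=> [->//|/H/ltnW].
Qed.

(** A key and its partner are neighbours in the cyclic order on what is left,
    so nothing left is separated from the rest by this pair. *)
Lemma mat_partnerP n k I : sorted ltn I -> 1 < size I -> key_val n k \in I ->
  let l := mat_partner n k I in
  [/\ l \in I, l != key_val n k &
      {in I, forall z, z != key_val n k -> z != l -> (z < key_val n k) = (z < l)}
      \/ {in I, forall z, minn (key_val n k) l <= z <= maxn (key_val n k) l}].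
Proof.
move=> sI szI aI.
have [b bI ba] : exists2 b : nat, b \in I & b != key_val n k.
  apply/hasP; apply: contraLR szI; rewrite -all_predC => /allP H.
  rewrite -leqNgt; apply: (@uniq_leq_size _ I [:: key_val n k]).
    by apply: sorted_uniq sI; [exact: ltn_trans | exact: ltnn].
  by move=> z /H /=; rewrite negbK inE.
have I0 : I != [::] by case: (I) aI.
case: k aI ba => [a'|a'] /= aI ba.
- set F := [seq x <- I | x < a'].
  have [F0|F0] := eqVneq F [::].
    rewrite F0 /=; have [lI maxl] := sorted_last 0 sI I0.
    have minI (z : nat) : z \in I -> a' <= z.
      move=> zI; rewrite leqNgt; apply/negP => za.
      suff: z \in F by rewrite F0.
      by rewrite mem_filter za.
    have := minI _ bI; have := maxl _ bI; have := minI _ lI.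
    by split=> //; [lia | right=> z zI; have := minI _ zI; have := maxl _ zI; lia].
  have sF : sorted ltn F by apply: sorted_filter sI; exact: ltn_trans.
  have [lF maxl] := sorted_last (last 0 I) sF F0.
  move: lF; rewrite mem_filter => /andP[la lI]; split=> //; first by lia.
  left=> z zI z1 z2; have [za|] := ltnP z a'; last by lia.
  by have := maxl z; rewrite mem_filter za zI => /(_ isT); lia.
- set c := n.*2.+1 - a' in aI ba *; set F := [seq x <- I | c < x].
  have [F0|F0] := eqVneq F [::].
    rewrite F0 /=; have [lI minl] := sorted_head 0 sI I0.
    have maxI (z : nat) : z \in I -> z <= c.
      move=> zI; rewrite leqNgt; apply/negP => za.
      suff: z \in F by rewrite F0.
      by rewrite mem_filter za.
    have := maxI _ bI; have := minl _ bI; have := maxI _ lI.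
    by split=> //; [lia | right=> z zI; have := maxI _ zI; have := minl _ zI; lia].
  have sF : sorted ltn F by apply: sorted_filter sI; exact: ltn_trans.
  have [lF minl] := sorted_head (head 0 I) sF F0.
  move: lF; rewrite mem_filter => /andP[la lI]; split=> //; first by lia.
  left=> z zI z1 z2; have [za|] := ltnP c z; last by lia.
  by have := minl z; rewrite mem_filter za zI => /(_ isT); lia.
Qed.

Lemma remaining_sorted n k I : sorted ltn I -> sorted ltn (remaining n k I).
Proof. by apply: sorted_filter; exact: ltn_trans. Qed.

Lemma perm_remaining n k I : sorted ltn I -> 1 < size I -> key_val n k \in I ->
  perm_eq (key_val n k :: mat_partner n k I :: remaining n k I) I.
Proof.
move=> sI szI aI; have [lI la _] := mat_partnerP sI szI aI.
have uI : uniq I by apply: sorted_uniq sI; [exact: ltn_trans | exact: ltnn].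
apply: uniq_perm => //=.
  by rewrite !inE !mem_filter filter_uniq // eq_sym (negbTE la) !eqxx.
move=> z; rewrite !inE mem_filter.
by case: eqVneq => [->|_] //=; case: eqVneq => [->|_] //=; rewrite lI.
Qed.

Definition mins (L : seq (nat * nat)) := [seq minn kl.1 kl.2 | kl <- L].
Definition maxs (L : seq (nat * nat)) := [seq maxn kl.1 kl.2 | kl <- L].

Section Run.
Variable n : nat.
Implicit Types (ks : seq key) (I : seq nat).

Lemma mat_pairs_perm ks I : sorted ltn I -> size I = (size ks).*2 ->
  keys_available n ks I ->
  perm_eq (mins (mat_pairs n ks I) ++ maxs (mat_pairs n ks I)) I.
Proof.
elim: ks I => [|k ks IHks] I sI szI /=; first by rewrite -(size0nil szI).
case/andP=> aI av; have szI1 : 1 < size I by rewrite szI.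
have pI := perm_remaining sI szI1 aI.
have szr : size (remaining n k I) = (size ks).*2.
  by have := perm_size pI; rewrite szI /=; lia.
have /seq.permP pr := IHks _ (remaining_sorted n k sI) szr av.
apply/seq.permP => a; have /seq.permP/(_ a) <- := pI.
move: (pr a); rewrite /mins /maxs /= !count_cat /= -/(remaining n k I).
by case: (leqP (key_val n k)); lia.
Qed.

Lemma mat_pairs_sub ks I : sorted ltn I -> size I = (size ks).*2 ->
  keys_available n ks I ->
  {in mat_pairs n ks I, forall kl, kl.1 \in I /\ kl.2 \in I}.
Proof.
move=> sI szI av kl klL; have /perm_mem pm := mat_pairs_perm sI szI av.
have : minn kl.1 kl.2 \in I.
  by rewrite -pm mem_cat (map_f (fun kl => minn kl.1 kl.2)).
have : maxn kl.1 kl.2 \in I.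
  by rewrite -pm mem_cat orbC (map_f (fun kl => maxn kl.1 kl.2)).
by case: leqP.
Qed.

Definition noncrossing_first (m : nat) (kl : nat * nat) : bool :=
  let: (x, y) := (minn kl.1 kl.2, maxn kl.1 kl.2) in
  ((x == 1) && (y == m)) || (1 < x) && ((x < m) == (y < m)).

(** A pair of neighbours separates nothing of what is left, so it cannot
    separate [1] from the future partner [m] of [1]; and when [1] is removed,
    its neighbour [m] is an extreme element of the rest. *)
Lemma first_pair_noncrossing ks I : sorted ltn I -> size I = (size ks).*2 ->
  keys_available n ks I -> 1 \in I -> {in I, forall z, 0 < z} ->
  exists m, [/\ m \in I, 1 < m & all (noncrossing_first m) (mat_pairs n ks I)].
Proof.
elim: ks I => [|k ks IHks] I sI szI /=; first by rewrite (size0nil szI).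
case/andP=> aI av I1 Ipos; have szI1 : 1 < size I by rewrite szI.
have pI := perm_remaining sI szI1 aI.
have szr : size (remaining n k I) = (size ks).*2.
  by have := perm_size pI; rewrite szI /=; lia.
have sr := remaining_sorted n k sI.
have [lI la adj] := mat_partnerP sI szI1 aI.
rewrite -/(remaining n k I); set a := key_val n k in aI la adj *.
set l := mat_partner n k I in lI la adj *.
have memr z : (z \in remaining n k I) = [&& z != a, z != l & z \in I].
  by rewrite mem_filter andbA.
have := Ipos _ aI; have := Ipos _ lI => lpos apos.
have [E1|] := boolP ((a == 1) || (l == 1)).
  exists (maxn a l); split; first by case: leqP.
    by lia.
  rewrite {1}/noncrossing_first /=; apply/andP; split; first by lia.
  apply/allP => -[x y] /(mat_pairs_sub sr szr av)[/=].
  rewrite !memr => /and3P[x1 x2 xI] /and3P[y1 y2 yI].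
  have := Ipos _ xI; have := Ipos _ yI; rewrite /noncrossing_first /=.
  case: adj => adj.
    by have := adj _ xI x1 x2; have := adj _ yI y1 y2; lia.
  by have := adj _ xI; have := adj _ yI; lia.
rewrite negb_or => /andP[a1 l1].
have [||m [mI m1 mL]] := IHks _ sr szr av.
- by rewrite memr !(eq_sym 1) a1 l1.
- by move=> z; rewrite memr => /and3P[_ _ /Ipos].
move: mI; rewrite memr => /and3P[ma ml mI].
exists m; split=> //; rewrite mL andbT /noncrossing_first /=.
case: adj => adj; first by have := adj _ mI ma ml; lia.
by have := adj _ I1; lia.
Qed.

End Run.

(** * The path of a matching *)

Definition mins_word (N : nat) (L : seq (nat * nat)) : path_word :=
  [seq if p \in mins L then Up else Rt | p <- iota 1 N].

Section MinsWord.
Variables (N : nat) (L : seq (nat * nat)).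
Hypothesis perfect : perm_eq (mins L ++ maxs L) (iota 1 N).

Lemma uniq_ends : uniq (mins L ++ maxs L).
Proof. by rewrite (perm_uniq perfect) iota_uniq. Qed.

Lemma nU_mins_word j : j <= N ->
  nU (take j (mins_word N L)) = count (fun x => x <= j) (mins L).
Proof.
move=> jN; rewrite -map_take take_iota (minn_idPl jN).
rewrite /nU count_map -!size_filter; apply: perm_size; apply: uniq_perm.
- exact/filter_uniq/iota_uniq.
- by apply: filter_uniq; have := uniq_ends; rewrite cat_uniq => /and3P[].
- move=> z; rewrite !mem_filter mem_iota /=.
  have := perm_mem perfect z; rewrite mem_cat mem_iota.
  by case: (z \in mins L) => //=; lia.
Qed.

Lemma nR_mins_word j : j <= N ->
  nR (take j (mins_word N L)) = count (fun x => x <= j) (maxs L).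
Proof.
move=> jN; have := nU_nR (take j (mins_word N L)).
rewrite nU_mins_word // size_takel ?size_map ?size_iota // => E.
have /seq.permP/(_ (fun x => x <= j)) := perfect; rewrite count_cat.
suff -> : count (fun x => x <= j) (iota 1 N) = j.
  by move=> C; move: E; rewrite -[RHS]C => /addnI.
rewrite -(subnKC jN) iotaD count_cat.
rewrite (@eq_in_count _ _ predT (iota 1 j)) ?count_predT ?size_iota; last first.
  by move=> z; rewrite mem_iota /=; lia.
rewrite (@eq_in_count _ _ pred0 (iota _ _)) ?count_pred0 ?addn0 // => z.
by rewrite mem_iota /=; lia.
Qed.

Lemma mins_word_dyck n : N = n.*2 -> dyck n (mins_word N L).
Proof.
move=> EN; have szw : size (mins_word N L) = N by rewrite size_map size_iota.
have szm : size (mins L) = size (maxs L) by rewrite !size_map.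
have szL : size (mins L) = n.
  by move: (perm_size perfect); rewrite size_cat size_iota -szm addnn EN => /double_inj.
have lt x : (x \in mins L) || (x \in maxs L) -> x <= N.
  by rewrite -mem_cat (perm_mem perfect) mem_iota; lia.
rewrite dyckE; have tN := take_size (mins_word N L); rewrite szw in tN.
apply/and3P; split.
- rewrite -tN nU_mins_word // (@eq_in_count _ _ predT) ?count_predT ?szL //.
  by move=> x xL /=; rewrite lt ?xL.
- rewrite -tN nR_mins_word // (@eq_in_count _ _ predT) ?count_predT -?szm ?szL //.
  by move=> x xL /=; rewrite lt ?xL ?orbT.
- rewrite -leqn0; apply/unmatched_le => j; rewrite szw addn0 => jN.
  rewrite nU_mins_word // nR_mins_word // /mins /maxs !count_map.
  by apply: sub_count => kl /=; lia.
Qed.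

Lemma nth_mins_word p : 0 < p <= N ->
  nth Rt (mins_word N L) p.-1 = if p \in mins L then Up else Rt.
Proof.
move=> pN; rewrite (nth_map 0) ?size_iota ?nth_iota; [|lia..].
by have -> : 1 + p.-1 = p by lia.
Qed.

Hypothesis N_gt1 : 1 < N.

Variable m : nat.
Hypotheses (m_gt1 : 1 < m) (m_le : m <= N) (mL : all (noncrossing_first m) L).

Lemma count_first : count (fun kl => minn kl.1 kl.2 == 1) L = 1.
Proof.
have /seq.permP/(_ (pred1 1)) := perfect; rewrite count_cat !count_map.
rewrite (@count_uniq_mem _ (iota 1 N)) ?iota_uniq // mem_iota.
rewrite (_ : _ && _ = true); last by lia.
rewrite [X in _ + X](@eq_in_count _ _ pred0) ?count_pred0 ?addn0 // => kl.
by move=> /(allP mL); rewrite /noncrossing_first /=; lia.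
Qed.

(** Before position [m] the pair [{1, m}] is open, and each other pair that is
    closed was opened. *)
Lemma mins_word_excess j : 0 < j < m ->
  nR (take j (mins_word N L)) < nU (take j (mins_word N L)).
Proof.
move=> jm; rewrite nU_mins_word ?nR_mins_word; [|lia..].
rewrite -addn1 -count_first /mins /maxs !count_map.
elim: L mL => //= kl L' IHL' /andP[klm /IHL'].
by move: klm; rewrite /noncrossing_first; lia.
Qed.

Lemma mins_word_return :
  nU (take m.-1 (mins_word N L)) = (nR (take m.-1 (mins_word N L))).+1.
Proof.
rewrite nU_mins_word ?nR_mins_word; [|lia..].
rewrite -addn1 -[in RHS]count_first /mins /maxs !count_map.
elim: L mL => //= kl L' IHL' /andP[klm /IHL'].
by move: klm; rewrite /noncrossing_first; lia.
Qed.

Lemma mem1_mins : 1 \in mins L.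
Proof.
have : has (fun kl => minn kl.1 kl.2 == 1) L by rewrite has_count count_first.
by case/hasP=> kl klL /eqP <-; apply: (map_f (fun kl => minn kl.1 kl.2)).
Qed.

Lemma mem_m_maxs : m \in maxs L.
Proof.
have : has (fun kl => minn kl.1 kl.2 == 1) L by rewrite has_count count_first.
case/hasP=> kl klL /eqP E; have /= := allP mL kl klL.
rewrite /noncrossing_first E /= orbF => /eqP <-.
exact: (map_f (fun kl => maxn kl.1 kl.2)).
Qed.

Lemma notin_mins x : x \in maxs L -> x \notin mins L.
Proof.
by have := uniq_ends; rewrite cat_uniq => /and3P[_ /hasPn H _] /H.
Qed.

(** The 0-based index of the letter [p - 1], taken cyclically. *)
Definition rotated p := if p <= 1 then N.-1 else p.-2.

(** Rotation keeps the order of all pairs but [{1, m}], whose end [1] becomes the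
    last position; this is also the effect of promotion, once [m] is known to be
    the first return of the path. *)
Lemma promotion_mins_word n (W : path_word) : N = n.*2 -> size W = N ->
  {in L, forall kl,
    nth Rt W (minn (rotated kl.1) (rotated kl.2)) = Up /\
    nth Rt W (maxn (rotated kl.1) (rotated kl.2)) = Rt} ->
  promotion n (mins_word N L) = W.
Proof.
move=> EN szW HW; have dw := mins_word_dyck EN.
set s := mins_word N L in dw *.
have szs : size s = N by rewrite size_map size_iota.
have [y Es] : exists y, s = Up :: y.
  have := nth_mins_word (p := 1); rewrite mem1_mins -/s /= => /(_ ltac:(lia)).
  by case: (s) szs => [|c y] /=; [lia | move=> _ ->; exists y].
have szy : size y = N.-1 by rewrite -szs Es.
have nthy i : nth Rt y i = nth Rt s i.+1 by rewrite Es.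
have ym : nth Rt y m.-2 = Rt.
  rewrite nthy; have -> : m.-2.+1 = m.-1 by lia.
  by rewrite nth_mins_word ?(negbTE (notin_mins mem_m_maxs)) //; lia.
set a := take m.-2 y; set b := drop m.-1 y.
have Ey : y = a ++ Rt :: b.
  rewrite -{1}(cat_take_drop m.-2 y) (drop_nth Rt) ?ym; last by lia.
  by have -> : m.-2.+1 = m.-1 by lia.
have sza : size a = m.-2 by rewrite size_takel; lia.
have takes j : j <= size a -> take j.+1 s = Up :: take j a.
  by move=> ja; rewrite Es Ey /= take_cat; case: ltngtP ja => // ->; rewrite subnn !take_size cats0.
rewrite Es Ey promotion_first_return -?Ey -?Es //.
- have szab : size (a ++ Up :: b) = N.-1 by rewrite -szy Ey !size_cat.
  apply: (@eq_from_nth _ Rt) => [|i]; rewrite size_rcons szab ?szW; first lia.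
  move=> iN; rewrite nth_rcons szab.
  have Wp p : 0 < p <= N -> p != 1 -> p != m ->
      nth Rt W p.-2 = if p \in mins L then Up else Rt.
    move=> pN p1 pm; have : p \in mins L ++ maxs L.
      by rewrite (perm_mem perfect) mem_iota; lia.
    rewrite mem_cat => /orP[pL|pL].
      rewrite pL; case/mapP: pL => kl klL Ep.
      have [<- _] := HW _ klL; congr nth.
      have := allP mL _ klL; rewrite /noncrossing_first /rotated -Ep (negbTE p1) /=.
      by rewrite /=; case: ifP => ?; case: ifP => ?; lia.
    rewrite (negbTE (notin_mins pL)); case/mapP: pL => kl klL Ep.
    have [_ WR] := HW _ klL; rewrite -[RHS]WR; congr nth.
    have := allP mL _ klL; rewrite /noncrossing_first /rotated -Ep [p == m](negbTE pm) /= andbF /=.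
    by rewrite /=; case: ifP => ?; case: ifP => ?; lia.
  have [klm klmL [E1 Em]] : exists2 kl, kl \in L & (minn kl.1 kl.2 = 1 /\ maxn kl.1 kl.2 = m).
    case/mapP: mem1_mins => kl klL E1'; exists kl => //; split=> //.
    by have := allP mL _ klL; rewrite /noncrossing_first /=; lia.
  case: klm klmL E1 Em => [x z] klmL E1 Em; rewrite /= in E1 Em.
  case: ltngtP => [iN1|iN1|->].
  + rewrite nth_cat sza; case: ltngtP => [im|im|im].
    * rewrite nth_take // nthy -[i.+1]/(i.+2.-1) nth_mins_word; last by lia.
      by rewrite -Wp //; lia.
    * have -> : nth Rt (Up :: b) (i - m.-2) = nth Rt y i.
        rewrite Ey nth_cat sza ltnNge (ltnW im) /=.
        by case E: (i - m.-2) => //; lia.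
      rewrite nthy -[i.+1]/(i.+2.-1) nth_mins_word; last by lia.
      by rewrite -Wp //; lia.
    * rewrite im subnn /=; have [<- _] := HW _ klmL; congr nth.
      by rewrite /rotated /=; case: ifP => h1; case: ifP => h2; lia.
  + by lia.
  + have [_ WR] := HW _ klmL; rewrite -[LHS]WR; congr nth.
    by rewrite /rotated; rewrite /=; case: ifP => ?; case: ifP => ?; lia.
- move=> j ja; have := @mins_word_excess j.+1; rewrite -/s takes //.
  by rewrite nU_cons nR_cons /=; lia.
- have := mins_word_return; have {1 2}-> : m.-1 = (size a).+1 by lia.
  rewrite -/s takes // take_size nU_cons nR_cons /=; lia.
Qed.

End MinsWord.

(** * The first rows of the two tableaux *)

Section FirstRow.
Variable f : nat -> nat.

(** The first row of the insertion tableau of [f 0], ..., [f (t - 1)]. *)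
Fixpoint row (t : nat) : seq nat :=
  if t is t'.+1 then (row_insert (f t') (row t')).1 else [::].

Definition bumped (t : nat) : option nat := (row_insert (f t) (row t)).2.

(** The lower rows have no influence on the first rows, and the recording
    tableau gets a new entry in its first row when nothing is bumped. *)
Lemma RS_first_rows v t : t <= size v -> (forall i, nth 0 v i = f i) ->
  let AB := foldl RS_step ([::], [::]) (take t (zip v (iota 1 (size v)))) in
  nth [::] AB.1 0 = row t /\
  nth [::] AB.2 0 = [seq i.+1 | i <- iota 0 t & bumped i == None].
Proof.
move=> + vf; elim: t => [|t IHt] tv; first by rewrite take0.
have [IHA IHB] := IHt (ltnW tv).
rewrite (take_nth (0, 0)) ?size_zip ?size_iota ?minnn //.
rewrite nth_zip ?size_iota // nth_iota // vf foldl_rcons.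
rewrite [iota 0 t.+1]iota_recr filter_rcons.
case: (foldl _ _ _) IHA IHB => [A B] /= IHA IHB; rewrite /RS_step /= /bumped.
rewrite add0n add1n -IHA; case: A {IHA} => [|r T] /=.
  by rewrite nth_set_nth /= IHB map_rcons.
case: (row_insert (f t) r) => r' [y|] /=; last first.
  by rewrite nth_set_nth /= IHB map_rcons.
case: (tab_insert y T) => T' k /=.
by rewrite nth_set_nth /= IHB.
Qed.

Lemma row_insertP x r : sorted ltn r -> x \notin r ->
  let: (r', b) := row_insert x r in
  [/\ sorted ltn r',
      forall z, (z \in r') = (z == x) || (z \in r) && (b != Some z) &
      if b is Some y then [/\ y \in r, x < y & {in r, forall z, x < z -> y <= z}]
      else {in r, forall z, z < x}].
Proof.
elim: r => [|y r IHr] /=; first by split=> // z; rewrite !inE orbF.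
move=> pr; rewrite inE negb_or => /andP[xy xr].
have mn z : z \in r -> y < z by have /allP := order_path_min ltn_trans pr; apply.
have yr : y \notin r by apply/negP => /mn; rewrite ltnn.
case: ltnP => [lt_xy|le_yx] /=.
- split=> [|z|].
  + by case: (r) pr => //= a r' /andP[ya ->]; rewrite (ltn_trans lt_xy).
  + rewrite !inE; case: eqVneq => //= _; rewrite (inj_eq Some_inj) (eq_sym y).
    by case: eqVneq => [->|_] /=; [rewrite (negbTE yr) | rewrite andbT].
  + split=> [||z]; rewrite ?inE ?eqxx // => /predU1P[->//|/mn/ltnW //].
- have lt_yx : y < x by rewrite ltn_neqAle eq_sym xy.
  have := IHr (path_sorted pr) xr.
  case: (row_insert x r) => r' b [sr' memr' Hb] /=; split=> [|z|].
  + rewrite (path_sortedE ltn_trans) sr' andbT; apply/allP => z.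
    by rewrite memr' => /predU1P[-> //|/andP[/mn]].
  + rewrite !inE memr'; case: (eqVneq z y) => [->|_] /=; last by [].
    case: b Hb {memr'} => [y' [yr' _ _]|_]; last by rewrite orbT.
    rewrite orbC; case: eqVneq => // -[E].
    by rewrite E (negbTE yr) in yr'.
  + case: b Hb {memr'} => [y' [yr' xy' mn']|Hb].
      split=> [||z]; rewrite ?inE ?yr' ?orbT // => /predU1P[->|/mn' //].
      by move=> xy2; have := ltn_trans xy2 lt_yx; rewrite ltnn.
    by move=> z; rewrite inE => /predU1P[->//|/Hb].
Qed.

Fixpoint running_max (t : nat) : nat :=
  if t is t'.+1 then maxn (running_max t') (f t') else 0.

Lemma running_max_ge t j : j < t -> f j <= running_max t.
Proof.
by elim: t => //= t IHt; rewrite ltnS leq_eqVlt => /predU1P[->|/IHt]; lia.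
Qed.

Lemma running_max_val t : 0 < t -> exists2 j, j < t & running_max t = f j.
Proof.
elim: t => //= t IHt _; case: leqP => H; first by exists t.
case: t IHt H => // t /(_ isT)[j jt E] _; exists j => //; lia.
Qed.

(** * Row insertion of a 321-avoiding permutation *)

Variable n : nat.
Hypothesis f_perm : perm_eq [seq f i | i <- iota 0 n] (iota 1 n).
Hypothesis f_321 : forall i j k, i < j -> j < k -> k < n -> ~ (f k < f j < f i).

Lemma f_inj i j : i < n -> j < n -> f i = f j -> i = j.
Proof.
move=> lin ljn E; have : uniq [seq f i | i <- iota 0 n].
  by rewrite (perm_uniq f_perm) iota_uniq.
move=> /(uniqP 0)/(_ i j); rewrite !inE size_map size_iota => /(_ lin ljn).
by rewrite !(nth_map 0) ?size_iota // !nth_iota // !add0n; apply.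
Qed.

Lemma f_range i : i < n -> 0 < f i <= n.
Proof.
move=> lin; have : f i \in iota 1 n.
  by rewrite -(perm_mem f_perm) map_f // mem_iota.
by rewrite mem_iota; lia.
Qed.

Lemma count_f_lt m : 0 < m <= n ->
  count (fun s => f s < m) (iota 0 n) = m.-1.
Proof.
move=> mn; have /seq.permP/(_ (fun x => x < m)) := f_perm.
rewrite count_map => ->; have -> : n = m.-1 + (n - m.-1) by lia.
rewrite iotaD count_cat (@eq_in_count _ _ predT (iota 1 _)); last first.
  by move=> z; rewrite mem_iota /=; lia.
rewrite (@eq_in_count _ _ pred0 (iota _ (n - _))); last first.
  by move=> z; rewrite mem_iota /=; lia.
by rewrite count_predT count_pred0 size_iota addn0.
Qed.

(** If a larger value preceded [f i], then every value below [f i] would come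
    before [i], by avoidance of 321; there are too few places left for them. *)
Lemma weak_excedance_record i : i < n -> i < f i -> forall j, j < i -> f j < f i.
Proof.
move=> lin fi j ji; rewrite ltnNge; apply/negP => fij.
have {fij} fij : f i < f j.
  by rewrite ltn_neqAle fij andbT; apply/eqP => /f_inj E; have := E lin; lia.
have := @count_f_lt (f i) (f_range lin).
rewrite -(subnKC (ltnW lin)) iotaD count_cat add0n.
rewrite (@eq_in_count _ _ pred0 (iota i _)); last first.
  move=> s; rewrite mem_iota (subnKC (ltnW lin)) => /andP[si sn] /=.
  apply/negbTE/negP => fsi; have [E|ne] := eqVneq s i; first by move: fsi; rewrite E ltnn.
  have lt_is : i < s by lia.
  by apply: (f_321 ji lt_is sn); rewrite fsi.
rewrite count_pred0 addn0 => E.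
have := count_predC (fun s => f s < f i) (iota 0 i); rewrite E size_iota.
have : 0 < count (predC (fun s => f s < f i)) (iota 0 i).
  rewrite -has_count; apply/hasP; exists j; first by rewrite mem_iota.
  by rewrite /= -leqNgt ltnW.
by lia.
Qed.

(** Otherwise the [i] values before [f i] would all be smaller than [f i <= i]. *)
Lemma deficiency_not_record i : i < n -> f i <= i -> exists2 j, j < i & f i < f j.
Proof.
move=> lin fi; have [/hasP[j]|H] := boolP (has (fun j => f i < f j) (iota 0 i)).
  by rewrite mem_iota => ji fij; exists j.
have := @count_f_lt (f i) (f_range lin).
rewrite -(subnKC (ltnW lin)) iotaD count_cat add0n.
rewrite (@eq_in_count _ _ predT (iota 0 i)); last first.
  move=> s; rewrite mem_iota => /andP[_ si] /=.
  move/hasPn: H => /(_ s); rewrite mem_iota si -leqNgt => /(_ isT).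
  rewrite leq_eqVlt => /predU1P[/f_inj E|//].
  by have := E (ltn_trans si lin) lin; lia.
by rewrite count_predT size_iota; have := f_range lin; lia.
Qed.

Lemma after_deficiency i j : i < j < n -> f i <= i -> f i < f j.
Proof.
move=> /andP[ij jn] fi; have lin := ltn_trans ij jn.
have [k ki fik] := deficiency_not_record lin fi.
rewrite ltnNge leq_eqVlt; apply/negP => /predU1P[/f_inj E|fji].
  by have := E jn lin; lia.
by apply: (f_321 ki ij jn); rewrite fji.
Qed.

Lemma running_max_exc t : t < n -> t < f t ->
  running_max t < f t /\ running_max t.+1 = f t.
Proof.
move=> tn ft /=; suff : running_max t < f t by lia.
case: t tn ft => [|t] tn ft; first by [].
have [j jt ->] := running_max_val (ltn0Sn t); exact: weak_excedance_record.
Qed.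

Lemma running_max_def t : t < n -> f t <= t ->
  f t < running_max t /\ running_max t.+1 = running_max t.
Proof.
move=> tn ft /=; suff : f t < running_max t by lia.
have [j jt fj] := deficiency_not_record tn ft.
by have := running_max_ge jt; lia.
Qed.

Lemma row_spec t : t <= n -> sorted ltn (row t) /\
  {in row t, forall z, exists2 j, j < t & f j = z}.
Proof.
elim: t => // t IHt tn; have [sr memr] := IHt (ltnW tn).
have ftr : f t \notin row t.
  by apply/negP => /memr[j jt /f_inj E]; have := E (ltn_trans jt tn) tn; lia.
have := row_insertP sr ftr; rewrite /= ; case: (row_insert _ _) => r' b [sr' memr' _].
split=> // z; rewrite /= memr' => /predU1P[->|/andP[/memr[j jt <-] _]].
  by exists t.
by exists j => //; lia.
Qed.

Lemma notin_row t : t < n -> f t \notin row t.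
Proof.
move=> tn; have [_ memr] := row_spec (ltnW tn).
by apply/negP => /memr[j jt /f_inj E]; have := E (ltn_trans jt tn) tn; lia.
Qed.

Lemma mem_rowS t z : t < n ->
  (z \in row t.+1) = (z == f t) || (z \in row t) && (bumped t != Some z).
Proof.
move=> tn; have [sr _] := row_spec (ltnW tn).
have := row_insertP sr (notin_row tn); rewrite /bumped /=.
by case: (row_insert _ _) => r' b [].
Qed.

Lemma bumpedP t : t < n ->
  if bumped t is Some y
  then [/\ y \in row t, f t < y & {in row t, forall z, f t < z -> y <= z}]
  else {in row t, forall z, z < f t}.
Proof.
move=> tn; have [sr _] := row_spec (ltnW tn).
have := row_insertP sr (notin_row tn); rewrite /bumped /=.
by case: (row_insert _ _) => r' b [].
Qed.

Lemma bumped_exc t : t < n -> t < f t -> bumped t = None.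
Proof.
move=> tn ft; have := bumpedP tn; case: (bumped t) => // y [yr fy _].
have [_ /(_ _ yr)[j jt E]] := row_spec (ltnW tn).
by have := weak_excedance_record tn ft jt; lia.
Qed.

(** A value that is not a maximum is smaller than all later ones, so that only
    maxima can be bumped. *)
Lemma bumped_val t y : t < n -> bumped t = Some y ->
  exists j, [/\ j < t, f j = y & j < f j].
Proof.
move=> tn E; have := bumpedP tn; rewrite E => -[yr fy _].
have [_ /(_ _ yr)[j jt Ej]] := row_spec (ltnW tn).
exists j; split=> //; rewrite ltnNge; apply/negP => /(@after_deficiency j t).
by rewrite jt tn => /(_ isT); lia.
Qed.

(** An entry inserted before [t] never comes back to the row once bumped. *)
Lemma row_mono t s j : t <= s <= n -> j < t -> f j \in row s -> f j \in row t.
Proof.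
elim: s => [|s IHs] /andP[ts sn] jt; first by have -> : t = 0 by lia.
have [->//|ne] := eqVneq t s.+1; rewrite mem_rowS // => /orP[/eqP/f_inj E|].
  by have := E ltac:(lia) sn; lia.
by case/andP=> fr _; apply: IHs; rewrite // -ltnS; lia.
Qed.

(** A value is bumped at most once, and is in the row exactly until then. *)
Lemma count_bumped t k : t + k < n ->
  count (fun s => bumped s == Some (f t)) (iota t.+1 k) +
  (f t \in row (t.+1 + k)) = 1.
Proof.
elim: k => [|k IHk] tk.
  by rewrite addn0 mem_rowS ?eqxx //; lia.
have {IHk} E := IHk ltac:(lia); rewrite iota_recr -cats1 count_cat /= addn0.
rewrite addnS mem_rowS; last by lia.
have -> : (f t == f (t.+1 + k)) = false.
  by apply/negbTE/eqP => /f_inj; lia.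
have := bumpedP (t := t.+1 + k) ltac:(lia).
have [->[fr _ _]|ne _] := eqVneq (bumped (t.+1 + k)) (Some (f t)).
  by rewrite andbF; move: E; rewrite fr; lia.
by rewrite andbT /= addn0.
Qed.

Lemma def_in_row t : t < n -> f t <= t -> f t \in row n.
Proof.
move=> tn ft; have := @count_bumped t (n - t.+1) ltac:(lia).
rewrite subnKC // (@eq_in_count _ _ pred0) ?count_pred0; first by case: (_ \in _).
move=> s; rewrite mem_iota => /andP[ts sn]; apply/negbTE/eqP.
have {}sn : s < n by lia.
by case/(bumped_val sn) => j [js /f_inj E]; rewrite E; lia.
Qed.

(** An entry bumped at a time [s >= t] and not exceeding [running_max t] was
    inserted before time [t]: a later entry is a new maximum, hence larger, or
    not a maximum, hence never bumped.  The bound is easier to follow through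
    time than the time of insertion. *)
Definition old_bump (t s : nat) : bool :=
  if bumped s is Some y then y <= running_max t else false.

Definition pending (t : nat) : nat := count (old_bump t) (iota t (n - t)).

Lemma pending_cons t : t < n ->
  pending t = old_bump t t + count (old_bump t) (iota t.+1 (n - t.+1)).
Proof. by move=> tn; rewrite /pending; have -> : n - t = (n - t.+1).+1 by lia. Qed.

Definition unused (t : nat) := count (fun s => f s < running_max t) (iota t (n - t)).

Lemma running_max_le t : t <= n -> running_max t <= n.
Proof.
case: t => // t tn; have [j jt ->] := running_max_val (ltn0Sn t).
by have /andP[] := @f_range j ltac:(lia).
Qed.

Lemma unusedE t : 0 < t <= n -> unused t + t = running_max t.
Proof.
move=> /andP[t0 tn]; have [j jt Ej] := running_max_val t0.
have jn := leq_trans jt tn.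
have r_range : 0 < running_max t <= n by rewrite Ej f_range.
have := count_f_lt r_range.
rewrite -{1}(subnKC tn) iotaD count_cat add0n -/(unused t).
have E1 : count (fun s => f s == running_max t) (iota 0 t) = 1.
  rewrite -(count_map f (pred1 (running_max t))) count_uniq_mem.
    by rewrite Ej map_f // mem_iota.
  rewrite map_inj_in_uniq ?iota_uniq // => x y.
  by rewrite !mem_iota => xt yt /f_inj; apply; lia.
have := count_predC (fun s => f s < running_max t) (iota 0 t); rewrite size_iota.
rewrite (@eq_in_count _ (predC _) (fun s => f s == running_max t)) ?E1; last first.
  by move=> s; rewrite mem_iota add0n => /andP[_ /running_max_ge] /=; lia.
by lia.
Qed.

(** The bound rises from one maximum to the next; as only maxima are bumped,
    this adds the bump of the new maximum, if it ever occurs. *)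
Lemma pending_exc t : t < n -> t < f t ->
  pending t.+1 + (f t \in row n) = (pending t).+1.
Proof.
move=> tn ft; have [lt_r Er] := running_max_exc tn ft.
have := @count_bumped t (n - t.+1) ltac:(lia); rewrite subnKC // => E.
rewrite (pending_cons tn) {1}/old_bump bumped_exc //= add0n.
suff -> : pending t.+1 = count (old_bump t) (iota t.+1 (n - t.+1)) +
   count (fun s => bumped s == Some (f t)) (iota t.+1 (n - t.+1)).
  by rewrite -addnA E addn1.
rewrite /pending /old_bump Er -count_predUI.
rewrite (@eq_in_count _ (predI _ _) pred0) ?count_pred0 ?addn0; last first.
  by move=> s _ /=; case: (bumped s) => //= y; case: eqVneq => [[->]|_]; lia.
apply: eq_in_count => s; rewrite mem_iota => /andP[ts sn] /=.
have {}sn : s < n by lia.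
case Es: (bumped s) => [y|] //=; have [j [js fj jf]] := bumped_val sn Es.
case: eqVneq => [[->]|ne]; first by rewrite leqnn orbT.
rewrite orbF -fj; have [tj|jt] := leqP t j.
  have [E1|nt] := eqVneq j t; first by rewrite -fj E1 eqxx in ne.
  have := @weak_excedance_record j ltac:(lia) jf t ltac:(lia).
  lia.
have := running_max_ge jt; lia.
Qed.

Lemma pending_def t : t < n -> f t <= t ->
  pending t.+1 + (bumped t != None) = pending t.
Proof.
move=> tn ft; have [lt_r Er] := running_max_def tn ft.
rewrite [RHS](pending_cons tn) /pending /old_bump Er addnC; congr (_ + _).
have := bumpedP tn; case: (bumped t) => // y [yr _ _].
have [_ /(_ _ yr)[j jt <-]] := row_spec (ltnW tn).
by rewrite (running_max_ge jt).
Qed.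

(** Each bump counted by [pending] is caused by a smaller value. *)
Lemma pending_le t : pending t <= unused t.
Proof.
rewrite /pending /unused /old_bump.
rewrite -!size_filter; apply: uniq_leq_size; first exact/filter_uniq/iota_uniq.
move=> s; rewrite !mem_filter => /andP[Hs st]; rewrite st andbT.
have sn : s < n by move: st; rewrite mem_iota; lia.
have := bumpedP sn; case: (bumped s) Hs => // y yr [_ fy _].
exact: leq_trans fy yr.
Qed.

(** While the maximum stays in the row, every smaller value that comes in finds
    an entry to bump, and this entry does not exceed the maximum. *)
Lemma pending_ge t : 0 < t <= n -> running_max t \in row n -> unused t <= pending t.
Proof.
move=> /andP[t0 tn] rn; have [j jt Ej] := running_max_val t0.
rewrite /pending /unused /old_bump.
rewrite -!size_filter; apply: uniq_leq_size; first exact/filter_uniq/iota_uniq.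
move=> s; rewrite !mem_filter => /andP[fs st]; rewrite st andbT.
move: st; rewrite mem_iota => st; have sn : s < n by lia.
have rs : running_max t \in row s.
  by rewrite Ej in rn *; apply: row_mono rn; lia.
have := bumpedP sn; case: (bumped s) => [y [_ _ /(_ _ rs)]|/(_ _ rs)]; lia.
Qed.

(** The number of times before [t] that are still unpaired when the key of time
    [t] is about to be processed; see [inv_count]. *)
Definition free_times (t : nat) : nat := pending t + (running_max t \in row n).

Lemma free_times1 : 0 < n -> free_times 1 = 1.
Proof.
move=> n0; have /andP[f0 _] := f_range n0; have E := pending_exc n0 f0.
rewrite /free_times /= max0n E; have := pending_le 0.
by rewrite /unused (@eq_in_count _ _ pred0) ?count_pred0 //; case: pending.
Qed.

Lemma free_times_end : 0 < n -> free_times n = (n \in row n).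
Proof.
move=> n0; have := @unusedE n; rewrite n0 leqnn => /(_ isT).
by rewrite /free_times /pending /unused subnn /= add0n => <-.
Qed.

(** If the current maximum stays in the row for ever, the values below it yet to
    come and the pending bumps are equally many. *)
Lemma free_times_exc t : 0 < t < n -> t < f t -> 
  if running_max t \in row n then
    free_times t = (unused t).+1 /\ free_times t.+1 = free_times t
  else free_times t <= unused t /\ free_times t.+1 = (free_times t).+1.
Proof.
move=> /andP[t0 tn] ft; have [_ Er] := running_max_exc tn ft.
rewrite /free_times Er (pending_exc tn ft); have le := pending_le t.
case: ifP => rn; rewrite rn /= ?addn0 ?addn1; last by [].
have ge : unused t <= pending t by apply: pending_ge; rewrite ?t0 ?(ltnW tn).
by split=> //; congr S; apply/eqP; rewrite eqn_leq le.
Qed.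

Lemma free_times_def_bump t : t < n -> f t <= t -> bumped t != None ->
  free_times t = (free_times t.+1).+1.
Proof.
move=> tn ft bt; have [_ Er] := running_max_def tn ft.
by rewrite /free_times Er -(pending_def tn ft) bt addn1 addSn.
Qed.

(** Here the previous maximum has already left the row, and all entries of the
    row are smaller than the value inserted, hence than all values to come that
    are not maxima. *)
Lemma free_times_def_nobump t : t < n -> f t <= t -> bumped t = None ->
  free_times t = 0 /\ free_times t.+1 = 0.
Proof.
move=> tn ft bt; have [fr Er] := running_max_def tn ft.
have [j jt Ej] : exists2 j, j < t & running_max t = f j.
  by apply: running_max_val; case: (t) fr.
have := bumpedP tn; rewrite bt => small.
have rn : (running_max t \in row n) = false.
  apply/negP; rewrite Ej => /(@row_mono t n j); rewrite leqnn (ltnW tn) jt.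
  by move=> /(_ isT isT) /small; rewrite -Ej; lia.
have p0 : pending t = 0.
  apply/eqP; rewrite -leqn0 leqNgt -has_count; apply/hasPn => s.
  rewrite mem_iota (subnKC (ltnW tn)) => /andP[ts sn]; rewrite /old_bump.
  have := bumpedP sn; case Es: (bumped s) => [y|] // [yr fy _].
  have [i [si Ei fi]] := bumped_val sn Es.
  rewrite -ltnNge -Ei; have [ti|it] := leqP t i.
    by rewrite Ej; apply: weak_excedance_record => //; lia.
  have [st|st] := eqVneq s t; first by rewrite st bt in Es.
  have /small : y \in row t.
    by rewrite -Ei in yr *; apply: row_mono yr; rewrite ?ts ?(ltnW sn).
  have := @after_deficiency t s; rewrite ft sn; lia.
rewrite /free_times Er rn p0 !addn0; split=> //.
by have := pending_def tn ft; rewrite p0; case: pending.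
Qed.


End FirstRow.

(** * The keys of a 321-avoiding permutation and its tableaux *)

Section Simulation.
Variables (n : nat) (f : nat -> nat).
Hypothesis n_gt0 : 0 < n.
Hypothesis f_perm : perm_eq [seq f i | i <- iota 0 n] (iota 1 n).
Hypothesis f_321 : forall i j k, i < j -> j < k -> k < n -> ~ (f k < f j < f i).

Notation row := (row f).
Notation bumped := (bumped f).
Notation running_max := (running_max f).
Notation unused := (unused f n).
Notation free_times := (free_times f n).

Definition perm_key (t : nat) : key :=
  if (t < n) && (t < f t) then Unbarred (running_max t).+1 else Barred t.

Definition rows_word : path_word :=
  [seq if i \in row n then Up else Rt | i <- iota 1 n] ++
  [seq if bumped t == None then Rt else Up | t <- rev (iota 0 n)].

Lemma size_rows_word : size rows_word = n.*2.
Proof. by rewrite size_cat !size_map size_rev !size_iota addnn. Qed.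

Definition letter (p : nat) : step := nth Rt rows_word (rotated n.*2 p).

Lemma letter_val p : 1 < p <= n.+1 ->
  letter p = if p.-1 \in row n then Up else Rt.
Proof.
move=> pn; rewrite /letter /rotated leqNgt (_ : 1 < p); last by lia.
rewrite /= nth_cat size_map size_iota (_ : p.-2 < n); last by lia.
rewrite (nth_map 0) ?size_iota ?nth_iota; try lia.
by rewrite (_ : 1 + p.-2 = p.-1) //; lia.
Qed.

Lemma letter_time t p : t < n -> (p == 1) && (t == 0) || (p == n.*2.+1 - t) ->
  letter p = if bumped t == None then Rt else Up.
Proof.
move=> tn pt; rewrite /letter /rotated.
have -> : (if p <= 1 then n.*2.-1 else p.-2) = n + (n.-1 - t).
  by case: ifP; lia.
rewrite nth_cat size_map size_iota ltnNge leq_addr /= addKn.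
rewrite (nth_map 0) ?size_rev ?size_iota; last by lia.
rewrite nth_rev ?size_iota ?nth_iota; try lia.
by rewrite (_ : 0 + (n - (n.-1 - t).+1) = t) //; lia.
Qed.

(** Before rotation, the value [v] is at position [v + 1] and the time [t] at
    position [2n + 1 - t], except that time 0 is at position 1.  When the key of
    time [t] is processed, [lo] holds at the values below the maximum and [hi] at
    the earlier times; the positions in between have not been touched yet. *)
Definition lo (t p : nat) : bool := 1 < p <= running_max t.
Definition hi (t p : nat) : bool := (p == 1) || (n.*2.+1 - t < p).

(** A smaller value left free is never bumped, and an earlier time left free did
    not bump: this is what [inv_lo] and [inv_hi] say in terms of letters. *)
Record invariant (t : nat) (I : seq nat) : Prop := Invariant {
  inv_sorted : sorted ltn I;
  inv_size : size I = (n.+1 - t).*2;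
  inv_range : forall p, p \in I -> 0 < p <= n.*2;
  inv_mid : forall p, running_max t < p <= n.*2.+1 - t -> p \in I;
  inv_lo : forall p, p \in I -> lo t p -> letter p = Up;
  inv_hi : forall p, p \in I -> hi t p -> letter p = Rt;
  inv_count : count (hi t) I = free_times t }.

Lemma running_max_bounds t : 0 < t <= n -> t <= running_max t <= n.
Proof.
move=> tn; have := unusedE f_perm tn; have := @running_max_le f n f_perm t; lia.
Qed.

(** The middle part is full, and the sizes of [I] and of its [hi] part are
    known. *)
Lemma count_lo t I : 0 < t <= n -> invariant t I ->
  count (lo t) I + free_times t = (unused t).+1.
Proof.
move=> tn inv; have := unusedE f_perm tn; have := running_max_bounds tn.
rewrite -(inv_count inv) => rb Eu; have := inv_size inv.
set mid := fun p => running_max t < p <= n.*2.+1 - t.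
have : count mid I = n.*2.+1 - t - running_max t.
  rewrite -size_filter -[RHS](size_iota (running_max t).+1).
  apply: perm_size; apply: uniq_perm.
  - apply: filter_uniq; apply: sorted_uniq (inv_sorted inv).
      exact: ltn_trans.
    exact: ltnn.
  - exact: iota_uniq.
  - move=> p; rewrite mem_filter mem_iota.
    have -> : (running_max t < p < (running_max t).+1 + (n.*2.+1 - t - running_max t)) = mid p.
      by rewrite /mid; lia.
    by case E: (mid p) => //=; rewrite (inv_mid inv).
suff -> : size I = count (lo t) I + count mid I + count (hi t) I by lia.
have := inv_range inv.
elim: (I) => //= p I' IHI H; rewrite IHI; last first.
  by move=> q qI; apply: H; rewrite inE qI orbT.
have := H p; rewrite inE eqxx => /(_ isT).
by rewrite /lo /hi /mid; lia.
Qed.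

(** A value strictly between two successive maxima is not a maximum, hence is
    never bumped. *)
Lemma new_value_letter t p : t < n ->
  (running_max t).+1 < p <= running_max t.+1 -> letter p = Up.
Proof.
move=> tn Hp; have rn : running_max t.+1 <= n by apply: running_max_le.
rewrite letter_val; last by lia.
suff -> : p.-1 \in row n by [].
have : p.-1 \in [seq f i | i <- iota 0 n].
  by rewrite (perm_mem f_perm) mem_iota; lia.
case/mapP=> s; rewrite mem_iota add0n => /andP[_ sn] Es.
rewrite Es; apply: def_in_row => //.
rewrite leqNgt; apply/negP => fs.
have [st|] := ltnP s t; first by have := running_max_ge f st; lia.
rewrite leq_eqVlt => /predU1P[E|ts].
  by rewrite -E in fs Es; have [_ Er] := running_max_exc f_perm f_321 tn fs; lia.
have [j jt Ej] := running_max_val f (ltn0Sn t).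
have := weak_excedance_record f_perm f_321 sn fs (j := j) ltac:(lia).
lia.
Qed.

Lemma key_mid t : 0 < t <= n ->
  running_max t < key_val n (perm_key t) <= n.*2.+1 - t.
Proof.
move=> tn; have := running_max_bounds tn; rewrite /perm_key.
by case: ifP => /=; lia.
Qed.

Lemma partner_exc t I : 0 < t <= n -> invariant t I ->
  let l := mat_partner n (Unbarred (running_max t).+1) I in
  l \in I /\ if has (lo t) I then lo t l else (0 < free_times t) ==> hi t l.
Proof.
move=> tn inv; have rb := running_max_bounds tn; have sI := inv_sorted inv.
have I0 : I != [::].
  by rewrite -size_eq0 (inv_size inv); lia.
rewrite /=; set F := [seq x <- I | x < (running_max t).+1].
have sF : sorted ltn F by apply: sorted_filter sI; exact: ltn_trans.
have [F0|F0] := eqVneq F [::].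
  have Fn p : p \in I -> (running_max t).+1 <= p.
    move=> pI; rewrite leqNgt; apply/negP => pr.
    suff: p \in F by rewrite F0.
    by rewrite mem_filter pr.
  rewrite F0 /=; have [lI maxl] := sorted_last 0 sI I0; split=> //.
  case: hasP => [[p /Fn pI]|_]; first by rewrite /lo; lia.
  apply/implyP; rewrite -(inv_count inv) -has_count => /hasP[q qI].
  have := maxl q qI; have := Fn q qI; rewrite /hi; lia.
have [lF maxl] := sorted_last (last 0 I) sF F0.
move: lF; rewrite mem_filter => /andP[la lI]; split=> //.
case: hasP => [[p pI pl]|Hn].
  have := maxl p; rewrite mem_filter pI andbT => H; move: (H ltac:(move: pl; rewrite /lo; lia)).
  by move: pl; rewrite /lo; lia.
apply/implyP => _; rewrite /hi; have := inv_range inv lI.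
have : ~~ lo t (last (last 0 I) F) by apply/negP => ll; apply: Hn; exists (last (last 0 I) F).
by rewrite /lo; lia.
Qed.

Lemma partner_def t I : 0 < t <= n -> invariant t I ->
  let l := mat_partner n (Barred t) I in
  l \in I /\ if 0 < free_times t then hi t l else has (lo t) I ==> lo t l.
Proof.
move=> tn inv; have rb := running_max_bounds tn; have sI := inv_sorted inv.
have I0 : I != [::].
  by rewrite -size_eq0 (inv_size inv); lia.
rewrite -(inv_count inv) -has_count.
rewrite /=; set F := [seq x <- I | n.*2.+1 - t < x].
have sF : sorted ltn F by apply: sorted_filter sI; exact: ltn_trans.
have [F0|F0] := eqVneq F [::].
  have Fn p : p \in I -> p <= n.*2.+1 - t.
    move=> pI; rewrite leqNgt; apply/negP => pr.
    suff: p \in F by rewrite F0.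
    by rewrite mem_filter pr.
  rewrite F0 /=; have [lI minl] := sorted_head 0 sI I0; split=> //.
  have lr := inv_range inv lI.
  case: hasP => [[p pI]|Hn].
    by have := Fn p pI; have := minl p pI; rewrite /hi; lia.
  apply/implyP => /hasP[p pI pl]; have := minl p pI.
  have : ~~ hi t (head 0 I) by apply/negP => ll; apply: Hn; exists (head 0 I).
  by move: pl; rewrite /lo /hi; lia.
have [lF minl] := sorted_head (head 0 I) sF F0.
move: lF; rewrite mem_filter => /andP[la lI]; split=> //.
have lh : hi t (head (head 0 I) F) by rewrite /hi la orbT.
by have -> : has (hi t) I by apply/hasP; exists (head (head 0 I) F).
Qed.

Definition well_lettered (kl : nat * nat) : Prop :=
  nth Rt rows_word (minn (rotated n.*2 kl.1) (rotated n.*2 kl.2)) = Up /\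
  nth Rt rows_word (maxn (rotated n.*2 kl.1) (rotated n.*2 kl.2)) = Rt.

Lemma well_lettered_lt x y : rotated n.*2 x < rotated n.*2 y ->
  letter x = Up -> letter y = Rt -> well_lettered (x, y) /\ well_lettered (y, x).
Proof.
rewrite /letter /well_lettered /= (maxnC (rotated _ y)) (minnC (rotated _ y)).
by move=> /ltnW lt Ex Ey; rewrite (minn_idPl lt) (maxn_idPr lt).
Qed.

Lemma rotated_hi t p k : 0 < t <= n -> k <= n.*2.+1 - t -> 1 < k -> p <= n.*2 -> hi t p ->
  rotated n.*2 k < rotated n.*2 p.
Proof.
by rewrite /rotated /hi; case: ifP => ?; case: ifP => ?; lia.
Qed.

Lemma rotated_lo t p k : lo t p -> running_max t < k -> rotated n.*2 p < rotated n.*2 k.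
Proof.
by rewrite /rotated /lo; case: ifP => ?; case: ifP => ?; lia.
Qed.

Lemma exc_key t : t < n -> t < f t -> perm_key t = Unbarred (running_max t).+1.
Proof. by rewrite /perm_key => -> ->. Qed.

Lemma def_key t : ~~ ((t < n) && (t < f t)) -> perm_key t = Barred t.
Proof. by rewrite /perm_key => /negbTE ->. Qed.

(** Counting tells whether a smaller value or an earlier time is free; this
    decides the nature of the partner [l], which agrees with the letter of [k]
    in the tableau word.  The last clause prepares [inv_count] at time [t + 1]. *)
Lemma pair_well_lettered t I : 0 < t <= n -> invariant t I ->
  let k := key_val n (perm_key t) in let l := mat_partner n (perm_key t) I in
  [/\ lo t l || hi t l, well_lettered (k, l) &
      t < n -> free_times t.+1 + hi t.+1 k + hi t.+1 l = (free_times t).+1].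
Proof.
move=> tn inv; have rb := running_max_bounds tn; have cl := count_lo tn inv.
have [/andP[tn' ft]|nexc] := boolP ((t < n) && (t < f t)).
  rewrite exc_key // => k l; have t0n : 0 < t < n by lia.
  have [lI] := partner_exc tn inv; have kE : k = (running_max t).+1 by [].
  rewrite -/l in lI *; clearbody k l; rewrite {k}kE; have lr := inv_range inv lI.
  have ftE := free_times_exc f_perm f_321 t0n ft.
  have lk := @letter_val (running_max t).+1 ltac:(lia); rewrite succnK in lk.
  rewrite has_count; case rn: (running_max t \in row n).
  + rewrite rn in ftE lk; have [ft1 ft2] := ftE.
    have -> : (0 < count (lo t) I) = false by lia.
    have -> : 0 < free_times t by lia.
    move=> /= hl; rewrite hl orbT; split=> //.
      apply: (proj1 (well_lettered_lt _ lk (inv_hi inv lI hl))).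
      by apply: rotated_hi tn _ _ _ hl; lia.
    by move=> _; rewrite ft2; move: hl; rewrite /hi; lia.
  + rewrite rn in ftE lk; have [ft1 ft2] := ftE.
    have -> : 0 < count (lo t) I by lia.
    move=> ll; rewrite ll; split=> //.
      apply: (proj2 (well_lettered_lt _ (inv_lo inv lI ll) lk)).
      by apply: rotated_lo ll _; lia.
    by move=> _; rewrite ft2; move: ll; rewrite /hi /lo; lia.
rewrite def_key // => k l; have [lI] := partner_def tn inv.
have kE : k = n.*2.+1 - t by [].
rewrite -/l in lI *; clearbody k l; have lr := inv_range inv lI.
have kn : 1 < k <= n.*2.+1 - t by rewrite kE; lia.
have kr : running_max t < k by rewrite kE; lia.
have up0 : 0 < free_times t -> letter k = Up -> hi t l -> well_lettered (k, l).
  move=> b0 lk hl; apply: (proj1 (well_lettered_lt _ lk (inv_hi inv lI hl))).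
  by apply: rotated_hi tn _ _ _ hl; lia.
have down0 : letter k = Rt -> lo t l -> well_lettered (k, l).
  move=> lk ll; apply: (proj2 (well_lettered_lt _ (inv_lo inv lI ll) lk)).
  by apply: rotated_lo ll _; lia.
have [tn'|] := ltnP t n; last first.
  move=> nt; have Et : t = n by lia.
  have ek : k.-1 = n by lia.
  have := letter_val (p := k) ltac:(lia); rewrite ek has_count.
  have Eb : free_times t = (n \in row n) by rewrite Et free_times_end.
  rewrite Eb; case rn: (n \in row n); rewrite ?rn /= in Eb * => lk.
    move=> /= hl; rewrite hl orbT; split; rewrite // ?ltnNge ?nt //.
    by apply: up0; rewrite ?Eb.
  have -> : (0 < count (lo t) I) = true by lia.
  move=> /= ll; rewrite ll; split; rewrite // ?ltnNge ?nt //.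
  exact: down0.
have fd : f t <= t by rewrite tn' -leqNgt in nexc.
have lk := @letter_time t k tn' ltac:(by rewrite kE eqxx orbT).
have [bt|bt] := eqVneq (bumped t) None.
  have [E1 E2] := free_times_def_nobump f_perm f_321 tn' fd bt.
  rewrite E1 has_count (_ : 0 < count (lo t) I) //=; last by lia.
  move=> ll; rewrite ll; split=> //; first by apply: down0; rewrite // lk bt.
  by rewrite E2; move: ll; rewrite /lo /hi kE; lia.
have E := free_times_def_bump f_perm tn' fd bt.
rewrite E /= => hl; rewrite hl orbT; split=> //.
  by apply: up0; rewrite // ?E // lk (negbTE bt).
by move: hl; rewrite /hi kE; lia.
Qed.

Lemma invariant_step t I : 0 < t < n -> invariant t I ->
  invariant t.+1 (remaining n (perm_key t) I).
Proof.
move=> t0n inv; have tn : 0 < t <= n by lia.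
have tn' : t < n by lia.
have rb := running_max_bounds tn; have [lmid _] := pair_well_lettered tn inv.
have kmid := key_mid tn; have kI := inv_mid inv kmid.
have sI := inv_sorted inv; have szI : 1 < size I by rewrite (inv_size inv); lia.
move=> /(_ tn'); have pI := perm_remaining sI szI kI.
have memr p : p \in remaining n (perm_key t) I ->
    [/\ p != key_val n (perm_key t), p != mat_partner n (perm_key t) I & p \in I].
  by rewrite mem_filter => /andP[/andP[]].
have rmono : running_max t <= running_max t.+1 by rewrite /= leq_maxl.
have exc_def : 
    if t < f t then key_val n (perm_key t) = (running_max t).+1 /\
                    running_max t < running_max t.+1
    else key_val n (perm_key t) = n.*2.+1 - t /\ running_max t.+1 = running_max t.
  case: ltnP => ft; first by have [lt ->] := running_max_exc f_perm f_321 tn' ft; rewrite exc_key.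
  have [_ ->] := running_max_def f_perm tn' ft; rewrite def_key //; lia.
move=> Ecount; split.
- exact: remaining_sorted.
- by have := perm_size pI; rewrite (inv_size inv) /=; lia.
- by move=> p /memr[_ _ /(inv_range inv)].
- move=> p pm; rewrite mem_filter (inv_mid inv) ?andbT; last by lia.
  move: lmid exc_def; rewrite /lo /hi; case: ifP; lia.
- move=> p /memr[pk _ pI'] pl; have [pr|pr] := leqP p (running_max t).
    by apply: (inv_lo inv pI'); move: pl; rewrite /lo; lia.
  apply: (@new_value_letter t) => //; move: pl exc_def; rewrite /lo.
  by case: ifP; lia.
- move=> p /memr[pk _ pI'] ph; have [hp|hp] := boolP (hi t p).
    exact: (inv_hi inv pI').
  have Ep : p = n.*2.+1 - t by move: ph hp; rewrite /hi; lia.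
  rewrite (@letter_time t) ?Ep ?eqxx ?orbT // (bumped_exc f_perm f_321 tn') //.
  by move: exc_def; case: ltnP => // _ [E _]; rewrite E Ep eqxx in pk.
- have uI : uniq I by apply: sorted_uniq sI; [exact: ltn_trans | exact: ltnn].
  (* Going from t to t + 1, the position of time t joins the earlier times. *)
  have Ec : count (hi t.+1) I = (count (hi t) I).+1.
    have hiE p : hi t.+1 p = hi t p || (p == n.*2.+1 - t) by rewrite /hi; lia.
    rewrite (eq_count hiE).
    have := count_predUI (hi t) (pred1 (n.*2.+1 - t)) I.
    rewrite [X in _ + X](@eq_in_count _ _ pred0) ?count_pred0 ?addn0; last first.
      by move=> p _ /=; rewrite /hi; lia.
    rewrite (count_uniq_mem _ uI) (inv_mid inv) ?addn1 //; lia.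
  have /seq.permP/(_ (hi t.+1)) := pI; rewrite /= Ec (inv_count inv).
  by lia.
Qed.

Lemma invariant_start : invariant 1 (iota 1 n.*2).
Proof.
have f0 := f_range f_perm n_gt0; have r1 : running_max 1 = f 0 by rewrite /= max0n.
split; rewrite ?r1.
- exact: iota_ltn_sorted.
- by rewrite size_iota; lia.
- by move=> p; rewrite mem_iota; lia.
- by move=> p; rewrite mem_iota; lia.
- move=> p _; rewrite /lo r1 => Hp; apply: (@new_value_letter 0) => //.
  by rewrite r1 /=; lia.
- move=> p; rewrite mem_iota /hi => pn hp.
  by rewrite (@letter_time 0) //; lia.
- rewrite (free_times1 f_perm f_321 n_gt0).
  rewrite (@eq_in_count _ _ (pred1 1)); last first.
    by move=> p; rewrite mem_iota /hi /=; lia.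
  by rewrite count_uniq_mem ?iota_uniq // mem_iota; lia.
Qed.

Lemma simulation k t I : t + k = n.+1 -> 0 < t -> (0 < k -> invariant t I) ->
  keys_available n [seq perm_key s | s <- iota t k] I /\
  forall kl, kl \in mat_pairs n [seq perm_key s | s <- iota t k] I -> well_lettered kl.
Proof.
elim: k t I => //= k IHk t I tk t0 /(_ isT) inv.
have tn : 0 < t <= n by lia.
have [_ wl _] := pair_well_lettered tn inv.
have kI : key_val n (perm_key t) \in I by apply: (inv_mid inv); apply: key_mid.
have [k0|av wlr] := IHk t.+1 (remaining n (perm_key t) I) ltac:(lia) isT.
  by apply: invariant_step => //; lia.
split; first by rewrite kI.
by move=> kl; rewrite inE => /predU1P[->//|/wlr].
Qed.

End Simulation.

(** * Reading the keys on the path *)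

Lemma nR_takeS s m : m < size s ->
  nR (take m.+1 s) = nR (take m s) + (nth Rt s m == Rt).
Proof. by move=> ms; rewrite (take_nth Rt ms) nR_rcons. Qed.

Lemma nU_takeS s m : m < size s ->
  nU (take m.+1 s) = nU (take m s) + (nth Rt s m == Up).
Proof. by move=> ms; rewrite (take_nth Rt ms) nU_rcons. Qed.

Lemma nR_take_mono s m1 m2 : m1 <= m2 -> nR (take m1 s) <= nR (take m2 s).
Proof.
move=> le; rewrite -(cat_take_drop m1 (take m2 s)) nR_cat take_takel //.
exact: leq_addr.
Qed.

Lemma right_step_at s x : x < nR s ->
  exists m, [/\ m < size s, nth Rt s m = Rt & nR (take m s) = x].
Proof.
elim: s x => [|c s IHs] x //; rewrite nR_cons.
case: c => /= H; first by have [m [ms sm Ex]] := IHs _ H; exists m.+1; rewrite /= nR_cons.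
case: x H => [|x] H; first by exists 0.
by have [m [ms sm Ex]] := IHs x H; exists m.+1; rewrite /= nR_cons Ex.
Qed.

Lemma right_step_uniq s m1 m2 : m1 < size s -> m2 < size s ->
  nth Rt s m1 = Rt -> nth Rt s m2 = Rt -> nR (take m1 s) = nR (take m2 s) ->
  m1 = m2.
Proof.
move=> ms1 ms2 s1 s2 E; have [lt|lt|//] := ltngtP m1 m2.
- by have := nR_take_mono s lt; rewrite nR_takeS // s1; lia.
- by have := nR_take_mono s lt; rewrite nR_takeS // s2; lia.
Qed.

Lemma row_posE n i s m : m < size s -> nth Rt s m = Up -> ycoord s m = n - i ->
  row_pos n i s = m.
Proof.
move=> ms sm Ey0; rewrite /row_pos -Ey0 -{1}(subnKC (ltnW ms)) iotaD filter_cat.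
have Ey : ycoord s m = size [seq k <- iota 0 m | nth Rt s k == Up].
  rewrite size_filter /ycoord -(map_nth_iota0 Rt (ltnW ms)) count_map.
  exact: eq_count.
by rewrite nth_cat Ey ltnn subnn -(subnSK ms) /= sm.
Qed.

Lemma take_rev_negb (P : path_word) m : m < size P ->
  take (size P - m.+1) (rev (map negb P)) = rev (map negb (drop m.+1 P)).
Proof. by move=> mP; rewrite take_rev size_map subKn // -map_drop. Qed.

Lemma nU_rev_negb s : nU (rev (map negb s)) = nR s.
Proof. by rewrite /nU count_rev count_map; apply: eq_count; case. Qed.

Lemma nR_rev_negb s : nR (rev (map negb s)) = nU s.
Proof. by rewrite /nR count_rev count_map; apply: eq_count; case. Qed.

Section PathKeys.
Variables (n : nat) (P : path_word) (f : nat -> nat).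
Hypothesis P_dyck : dyck n P.
Hypothesis f_perm : perm_eq [seq f i | i <- iota 0 n] (iota 1 n).
Hypothesis f_321 : forall i j k, i < j -> j < k -> k < n -> ~ (f k < f j < f i).
Hypothesis P_peaks : forall x y,
  is_peak P x y <-> [/\ x < n, x < f x & y = f x].

Lemma size_dyck : size P = n.*2.
Proof.
by move: P_dyck; rewrite dyckE -nU_nR => /and3P[/eqP-> /eqP-> _]; rewrite addnn.
Qed.

Lemma dyck_nU_nR m : nR (take m P) <= nU (take m P).
Proof.
move: P_dyck; rewrite dyckE => /and3P[_ _ P0].
have {P0} H : unmatched P <= 0 by rewrite (eqP P0).
have [mP|Pm] := leqP m (size P).
  by move/unmatched_le: H => /(_ m mP); rewrite addn0.
have /unmatched_le/(_ (size P) (leqnn _)) := H.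
by rewrite take_size take_oversize ?addn0 // ltnW.
Qed.

Lemma previous_right_step m : m < size P -> nth Rt P m = Rt ->
  ~ is_peak P (nR (take m P)) (nU (take m P)) ->
  [/\ 0 < m, nth Rt P m.-1 = Rt,
      nR (take m P) = (nR (take m.-1 P)).+1 & nU (take m P) = nU (take m.-1 P)].
Proof.
move=> mP Pm npeak; have m0 : 0 < m.
  rewrite lt0n; apply/eqP => m0; move: mP Pm; rewrite m0 => P0 PR.
  have := dyck_nU_nR 1; rewrite nR_takeS // nU_takeS // PR.
  by rewrite take0.
have mP' : m.-1 < size P by lia.
have Pm' : nth Rt P m.-1 = Rt.
  apply/eqP; case: eqP => // /eqP PU; case: npeak; exists m.
  rewrite m0 mP; split=> //; last by rewrite (set_nth_default Rt).
  by case: (nth Rt P m.-1) PU.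
have := nR_takeS mP'; have := nU_takeS mP'; rewrite Pm' prednK //= => -> ->.
by split; rewrite ?addn0 ?addn1.
Qed.

Lemma peak_at m : m < size P -> nth Rt P m = Rt ->
  nR (take m P) < f (nR (take m P)) -> nR (take m P) < n ->
  [/\ 0 < m, nth Rt P m.-1 = Up & nU (take m P) = f (nR (take m P))].
Proof.
move=> mP Pm fx xn; set x := nR _ in fx xn *.
have [k [/andP[k0 kP] Uk Rk Ex Ey]] : is_peak P x (f x) by apply/P_peaks.
have -> : m = k; last by split.
apply: (@right_step_uniq P) => //; first by rewrite (set_nth_default Up).
Qed.

(** Columns where the height jumps start with a peak, whose height is the new
    maximum; in the other columns neither the height nor the maximum changes. *)
Lemma height_record x m : x < n -> m < size P -> nth Rt P m = Rt ->
  nR (take m P) = x -> nU (take m P) = running_max f x.+1.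
Proof.
elim: x m => [|x IHx] m xn mP Pm Ex.
  have := f_range f_perm xn => f0.
  have := @peak_at m mP Pm; rewrite Ex => -[]; rewrite //; first lia.
  by move=> _ _ ->; rewrite /= max0n.
have [fx|fx] := ltnP x.+1 (f x.+1).
  have := @peak_at m mP Pm; rewrite Ex => -[] // _ _ ->.
  by have [_ ->] := running_max_exc f_perm f_321 xn fx.
have [|m0 Pm' Ex' ->] := previous_right_step mP Pm.
  by rewrite Ex => /P_peaks[_]; lia.
have [_ ->] := running_max_def f_perm xn fx.
by apply: IHx; lia.
Qed.

Lemma next_step x m : x < n -> m < size P -> nth Rt P m = Rt ->
  nR (take m P) = x ->
  ((m.+1 < size P) && (nth Rt P m.+1 == Up)) = (x.+1 < n) && (x.+1 < f x.+1).
Proof.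
move=> xn mP Pm Ex; have [x1n|nx] := ltnP x.+1 n; last first.
  have Ex1 : x.+1 = n by lia.
  have := nR_takeS mP; rewrite Pm Ex /= => E.
  have := dyck_nU_nR m.+1; have := nU_nR (take m.+1 P).
  by rewrite size_takel // size_dyck; lia.
have RP : x.+1 < nR P.
  by move: P_dyck; rewrite dyckE => /and3P[_ /eqP-> _].
have [k [kP Pk Ek]] := right_step_at RP.
have km : m < k.
  by rewrite ltnNge; apply/negP => /(nR_take_mono P); lia.
have m1P : m.+1 < size P by lia.
rewrite m1P /=; have [fx|fx] := ltnP x.+1 (f x.+1).
  have := @peak_at k kP Pk; rewrite Ek => -[] // k0 Uk _.
  apply/eqP; case E: (nth Rt P m.+1) => //.
  have Ek' : k = m.+1.
    apply: (@right_step_uniq P) => //.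
    by rewrite Ek nR_takeS // Pm Ex /= addn1.
  by move: Uk; rewrite Ek' /= Pm.
have [|k0 Pk' Ek' _] := previous_right_step kP Pk.
  by rewrite Ek => /P_peaks[_]; lia.
have Em : k.-1 = m.
  apply: (@right_step_uniq P); rewrite //; first by lia.
  by apply: succn_inj; rewrite -Ek' Ek Ex.
by rewrite -Em prednK // Pk.
Qed.

(** Row [i] of the reflected path is column [i] of [P], so the valley of that
    row is at the up step following the [i]-th right step of [P]; the height of
    this valley is the maximum of the first [i] values. *)
Lemma mat_key_reflect i : 0 < i <= n ->
  mat_key n (rev (map negb P)) i = perm_key n f i.
Proof.
case: i => // x xn; have x_lt : x < n by lia.
have RP : x < nR P by move: P_dyck; rewrite dyckE => /and3P[_ /eqP-> _].
have [m [mP Pm Ex]] := right_step_at RP.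
set Q := rev (map negb P); have szQ : size Q = size P by rewrite size_rev size_map.
have nthQ k : k < size P -> nth Rt Q (size P - k.+1) = ~~ nth Rt P k.
  move=> kP; have lt_k : size P - k.+1 < size P by lia.
  rewrite nth_rev size_map; last exact: lt_k.
  have -> : size P - (size P - k.+1).+1 = k by lia.
  by rewrite (nth_map Rt).
have dR := nR_cat (take m.+1 P) (drop m.+1 P).
have dU := nU_cat (take m.+1 P) (drop m.+1 P).
rewrite cat_take_drop nR_takeS // Pm Ex /= in dR.
rewrite cat_take_drop nU_takeS // Pm /= addn0 in dU.
have [nUP nRP] : nU P = n /\ nR P = n.
  by move: P_dyck; rewrite dyckE => /and3P[/eqP-> /eqP-> _].
have posE : row_pos n x.+1 Q = size P - m.+1.
  apply: row_posE; first by rewrite szQ; lia.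
    by rewrite nthQ // Pm.
  by rewrite /ycoord take_rev_negb // -/(nU _) nU_rev_negb; lia.
rewrite /mat_key posE /perm_key -(next_step x_lt mP Pm Ex).
have -> : (0 < size P - m.+1) && (nth Up Q (size P - m.+1).-1 == Rt) =
          (m.+1 < size P) && (nth Rt P m.+1 == Up).
  rewrite subn_gt0; case: ltnP => //= m1P.
  have -> : (size P - m.+1).-1 = size P - m.+2 by lia.
  rewrite (set_nth_default Rt) ?nthQ //; last by rewrite szQ; lia.
  by case: (nth Rt P m.+1).
case: ifP => // _; congr Unbarred.
rewrite /xcoord take_rev_negb // -/(nR _) nR_rev_negb.
by rewrite -(height_record x_lt mP Pm Ex); lia.
Qed.

End PathKeys.

(** * From permutations to sequences of values *)

Section Values.
Variables (n : nat) (w : 'S_n).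

Definition value (i : nat) : nat := nth 0 (one_line w) i.

Lemma size_one_line : size (one_line w) = n.
Proof. by rewrite size_map size_enum_ord. Qed.

Lemma value_ord (i : 'I_n) : value i = (w i).+1.
Proof.
by rewrite /value (nth_map i) ?size_enum_ord // nth_ord_enum.
Qed.

Lemma value_perm : perm_eq [seq value i | i <- iota 0 n] (iota 1 n).
Proof.
rewrite -{1}size_one_line map_nth_iota0 // take_size.
apply: uniq_perm; last 1 first.
- move=> v; rewrite mem_iota; apply/mapP/idP => [[i _ ->]|vn].
    by have := ltn_ord (w i); lia.
  have vn' : v.-1 < n by lia.
  exists ((w^-1)%g (Ordinal vn')); first by rewrite mem_enum.
  by rewrite permKV /=; lia.
- by rewrite map_inj_uniq ?enum_uniq // => i j [/val_inj/perm_inj].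
- exact: iota_uniq.
Qed.

Lemma RSKhat_rows : RSKhat w = rows_word n value.
Proof.
rewrite /RSKhat /RSKhat_word /RS.
have := @RS_first_rows value (one_line w) (size (one_line w)) (leqnn _) (frefl _).
rewrite take_oversize ?size_zip ?size_iota ?minnn // size_one_line.
case: (foldl _ _ _) => A B /= [-> ->]; congr cat.
rewrite -[1]addn0 iotaDl -map_rev -map_comp; apply/eq_in_map => t /=.
rewrite mem_rev => tn; rewrite !add1n mem_map; last exact: succn_inj.
by rewrite mem_filter tn andbT.
Qed.

End Values.

Theorem theorem5p11 (n : nat) (P : path_word) (hP : dyck n P)
    (w : 'S_n) (hw : avoids321 w) (hwP : corresponds w P) :
  RSKhat w = promotion n (Mat n (evacuation n P)).
Proof.
rewrite RSKhat_rows evacuationE //; have [n0|n_gt0] := posnP n.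
  by move: w hw hwP hP; rewrite n0.
have f_321 i j k : i < j -> j < k -> k < n -> ~ (value w k < value w j < value w i).
  move=> ij jk kn; have jn := ltn_trans jk kn; have lin := ltn_trans ij jn.
  rewrite (value_ord w (Ordinal kn)) (value_ord w (Ordinal jn)).
  rewrite (value_ord w (Ordinal lin)) !ltnS => /andP.
  exact: (hw (Ordinal lin) (Ordinal jn) (Ordinal kn)).
have f_perm := value_perm w.
have peaks x y : is_peak P x y <-> [/\ x < n, x < value w x & y = value w x].
  split=> [/hwP[i [iw -> ->]]|[xn xw ->]].
    by rewrite value_ord ltnS.
  apply/hwP; exists (Ordinal xn); move: xw.
  by rewrite (value_ord w (Ordinal xn)) ltnS.
set Q := rev _; have matchingE : matching n Q =
    mat_pairs n [seq perm_key n (value w) s | s <- iota 1 n] (iota 1 n.*2).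
  rewrite /matching; congr mat_pairs; apply/eq_in_map => i.
  rewrite mem_iota => i_range; apply: mat_key_reflect => //; lia.
have inv := invariant_start n_gt0 f_perm f_321.
have [av wl] := simulation n_gt0 f_perm f_321 (add1n n) isT (fun _ => inv).
have sI := iota_ltn_sorted 1 n.*2.
have szI : size (iota 1 n.*2) = (size [seq perm_key n (value w) s | s <- iota 1 n]).*2.
  by rewrite size_map !size_iota.
have [||m [mI m1 mL]] := first_pair_noncrossing sI szI av.
- by rewrite mem_iota; lia.
- by move=> z; rewrite mem_iota; lia.
rewrite /Mat matchingE -/(mins _) -/(mins_word _ _).
symmetry; apply: (@promotion_mins_word _ _ _ _ m) => //.
- exact: mat_pairs_perm.
- by lia.
- by move: mI; rewrite mem_iota; lia.
- exact: size_rows_word.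
Qed.
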